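(* Let $\psi\colon\mathbb{M}_{m,n}\to\mathbb{R}$ be twice differentiable and let $f\colon\mathbb{R}^n\to[-\infty,+\infty]$ be absolutely symmetric, lower semicontinuous, convex, and locally Lipschitz continuous relative to its domain. Consider the problem $$(P)\qquad\min_{X\in\mathbb{M}_{m,n}}\ \psi(X)+(f\circ\sigma)(X).$$ Let $X_0$ be a feasible solution of $(P)$ (i.e. $(f\circ\sigma)(X_0)$ is finite), suppose $Y:=-\nabla\psi(X_0)\in\partial(f\circ\sigma)(X_0)$, and assume that $f$ is parabolically epi-differentiable at $\sigma(X_0)$ and parabolically regular at $\sigma(X_0)$ for $\sigma(Y)$. Let $(U,V)\in\mathcal{O}^{m,n}(X_0)\cap\mathcal{O}^{m,n}(Y)$ and, for $H\in\mathbb{M}_{m,n}$, put $$\begin{aligned}q(H)={}&\nabla^2\psi(X_0)(H,H)+\mathrm{d}^2f(\sigma(X_0)\mid\sigma(Y))(\sigma'(X_0;H))\\&+2\sum_{i=1}^t\Big\langle\Sigma(Y)_{\alpha_i\alpha_i},\,P_{\alpha_i}^T\mathcal{B}(H)P_{\alpha_i}^c(\mu_iI-\varLambda_{\alpha_i})^{-1}(P_{\alpha_i}^c)^T\mathcal{B}(H)P_{\alpha_i}\Big\rangle\\&+2\Big\langle\Sigma(Y)_{\hat\beta\beta},\,-U_{\hat\beta}^THV_\alpha\Sigma_\alpha^{-1}(X_0)U_\alpha^THV_\beta\Big\rangle.\end{aligned}$$ Then: (i) If $X_0$ is a local minimizer of $(P)$, then $q(H)\ge0$ for all $H\in K_{f\circ\sigma}(X_0,-\nabla\psi(X_0))$.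 (ii) One has $q(H)>0$ for all nonzero $H\in K_{f\circ\sigma}(X_0,-\nabla\psi(X_0))$ if and only if there exist $\epsilon>0$ and $c>0$ such that $$\psi(X)+(f\circ\sigma)(X)\ \ge\ \psi(X_0)+(f\circ\sigma)(X_0)+c\|X-X_0\|^2\quad\text{whenever }\|X-X_0\|\le\epsilon.$$
   Context: Matrix notation. $m,n$ are natural numbers, $n\le m$; $\mathbb{M}_{m,n}$ is the space of real $m\times n$ matrices, $\langle A,B\rangle=\mathrm{tr}(A^TB)$, Frobenius norm $\|\cdot\|$. $\sigma(X)$ is the vector of singular values in nonincreasing order, $\Sigma(X)$ the $m\times n$ diagonal matrix with diagonal $\sigma(X)$. $\mathcal{O}^{m,n}(X)$ is the set of pairs $(U,V)$ of orthogonal matrices ($m\times m$, $n\times n$) with $X=U\Sigma(X)V^T$. With $r=\mathrm{rank}\,X_0$ and $\mu_1>\dots>\mu_t$ the distinct nonzero singular values of $X_0$: $\alpha=\{1,\dots,r\}$, $\beta=\{r+1,\dots,n\}$, $\beta_0=\{n+1,\dots,m\}$, $\hat\beta=\beta\cup\beta_0$, $\alpha_i=\{s\in\alpha:\sigma_s(X_0)=\mu_i\}$. $U_I$, $V_I$ denote the submatrices of columns indexed by $I$; $A_{IJ}$ is the submatrix with rows in $I$ and columns in $J$; $\Sigma_\alpha(X_0)$ is the $r\times r$ diagonal matrix with diagonal $\sigma_1(X_0),\dots,\sigma_r(X_0)$. $\mathcal{B}(X)=\begin{bmatrix}0&X\\ X^T&0\end{bmatrix}$, $P=\frac1{\sqrt2}\begin{bmatrix}U_\alpha&U_\beta&\sqrt2U_{\beta_0}&-U_\alpha&-U_\beta\\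 V_\alpha&V_\beta&0&V_\alpha&V_\beta\end{bmatrix}$, an orthogonal matrix diagonalizing $\mathcal{B}(X_0)$. $P_{\alpha_i}=\frac1{\sqrt2}\begin{bmatrix}U_{\alpha_i}\\ V_{\alpha_i}\end{bmatrix}$; $P_{\alpha_i}^c$ is $P$ with those columns removed; $\varLambda_{\alpha_i}$ is the diagonal matrix of size $m+n-|\alpha_i|$ of the diagonal entries of $P^T\mathcal{B}(X_0)P$ different from $\mu_i$, in the order of the columns of $P_{\alpha_i}^c$. Variational notions. $\sigma'(X;H)=\lim_{t\downarrow0}(\sigma(X+tH)-\sigma(X))/t$ (always exists). $f$ is absolutely symmetric if $f(Qx)=f(x)$ for all $x$ and all signed permutation matrices $Q$. $g$ is locally Lipschitz continuous relative to its domain if for every $\bar x\in\mathrm{dom}\,g=\{g<\infty\}$, $g(\bar x)$ is finite and $g$ is Lipschitz on $O\cap\mathrm{dom}\,g$ for some neighborhood $O$ of $\bar x$. $\partial$ is the convex subdifferential. For $g$ with $g(\bar x)$ finite: $\mathrm{d}g(\bar x)(w)=\liminf_{t\downarrow0,w'\to w}\frac{g(\bar x+tw')-g(\bar x)}t$; $\mathrm{d}^2g(\bar x\mid v)(w)=\liminf_{\tau\downarrow0,w'\to w}\frac{g(\bar x+\tau w')-g(\bar x)-\tau\langle v,w'\rangle}{\frac12\tau^2}$; critical cone $K_g(\bar x,v)=\{w:\mathrm{d}g(\bar x)(w)=\langle v,w\rangle\}$; for $\mathrm{d}g(\bar x)(w)$ finite, $\mathrm{d}^2g(\bar x)(w\mid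 z)=\liminf_{\tau\downarrow0,z'\to z}\frac{g(\bar x+\tau w+\frac12\tau^2z')-g(\bar x)-\tau\mathrm{d}g(\bar x)(w)}{\frac12\tau^2}$. $g$ is parabolically epi-differentiable at $\bar x$ if for every $w$ with $\mathrm{d}g(\bar x)(w)$ finite: $\mathrm{dom}\,\mathrm{d}^2g(\bar x)(w\mid\cdot)\neq\emptyset$ and for every $z$ and $\tau_k\downarrow0$ there is $z_k\to z$ with $\frac{g(\bar x+\tau_kw+\frac12\tau_k^2z_k)-g(\bar x)-\tau_k\mathrm{d}g(\bar x)(w)}{\frac12\tau_k^2}\to\mathrm{d}^2g(\bar x)(w\mid z)$. $g$ is parabolically regular at $\bar x$ for $v$ if $g(\bar x)$ is finite and $\mathrm{d}^2g(\bar x\mid v)(w)=\inf_z\{\mathrm{d}^2g(\bar x)(w\mid z)-\langle v,z\rangle\}$ for every $w\in K_g(\bar x,v)$. *)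

(* Defs.v *)
From HB Require Import structures.
From mathcomp Require Import all_boot all_order all_algebra all_fingroup.
From mathcomp Require Import all_classical all_reals all_analysis.

Set Implicit Arguments.
Unset Strict Implicit.
Unset Printing Implicit Defensive.

Import Order.TTheory GRing.Theory Num.Theory.
Import numFieldNormedType.Exports.

Local Open Scope classical_set_scope.
Local Open Scope ring_scope.

Section Matrices.
Context {R : realType}.

(* Vectors of R^n are columns, so that everything below that is stated for
   p x q matrices also covers functions on R^n, with <x, y> = tr (x^T y). *)
Definition mxdot p q (A B : 'M[R]_(p, q)) : R := \tr (A^T *m B).

(* The norm of the library on matrices is the sup norm. *)
Definition frobenius p q (A : 'M[R]_(p, q)) : R := Num.sqrt (mxdot A A).

Definition orthogonal_mx p (U : 'M[R]_p) : Prop := U^T *m U = 1%:M.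

Definition signed_perm_mx p (Q : 'M[R]_p) : Prop :=
  exists (s : 'S_p) (e : 'I_p -> bool),
    Q = diag_mx (\row_i (-1) ^+ e i) *m perm_mx s.

(* Entries are square roots of the eigenvalues of X^T X with multiplicity, in
   nonincreasing order. Such a vector exists and is unique: see
   is_singular_values_uniq and sigmaP below. *)
Definition is_singular_values m n (X : 'M[R]_(m, n)) (s : 'cV[R]_n) : Prop :=
  [/\ forall i, 0 <= s i 0,
      forall i j : 'I_n, (i <= j)%N -> s j 0 <= s i 0
    & char_poly (X^T *m X) = \prod_(i < n) ('X - (s i 0 ^+ 2)%:P)].

Definition sigma m n (X : 'M[R]_(m, n)) : 'cV[R]_n :=
  xget 0 [set s | is_singular_values X s].

Definition Sigma m n (X : 'M[R]_(m, n)) : 'M[R]_(m, n) :=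
  \matrix_(i < m, j < n) (if (i : nat) == j then sigma X j 0 else 0).

(* The set O^{m,n}(X). *)
Definition svd_pairs m n (X : 'M[R]_(m, n)) : set ('M[R]_m * 'M[R]_n) :=
  [set UV | [/\ orthogonal_mx UV.1, orthogonal_mx UV.2
              & X = UV.1 *m Sigma X *m UV.2^T]].

Definition dsigma m n (X H : 'M[R]_(m, n)) : 'cV[R]_n :=
  lim ((fun t : R => t^-1 *: (sigma (X + t *: H) - sigma X)) @ 0^'+).

Definition gradient p q (psi : 'M[R]_(p, q) -> R) (X : 'M[R]_(p, q)) :
    'M[R]_(p, q) :=
  \matrix_(i, j) 'd psi X (delta_mx i j).

Definition twice_differentiable p q (psi : 'M[R]_(p, q) -> R) : Prop :=
  (forall X, differentiable psi X) /\
  (forall X, differentiable (gradient psi) X).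

Definition hessian p q (psi : 'M[R]_(p, q) -> R) (X H H' : 'M[R]_(p, q)) : R :=
  mxdot ('d (gradient psi) X H) H'.

Definition absolutely_symmetric n (f : 'cV[R]_n -> \bar R) : Prop :=
  forall (x : 'cV[R]_n) (Q : 'M[R]_n), signed_perm_mx Q -> f (Q *m x) = f x.

End Matrices.

Section Variational.
Context {R : realType} {p q : nat}.
Local Notation E := 'M[R]_(p, q).
Implicit Types (g : E -> \bar R) (x v w z : E).

Definition edom g : set E := [set x | (g x < +oo)%E].

(* Convexity of an extended-real-valued function is convexity of its epigraph,
   which avoids any convention for (+oo) + (-oo). *)
Definition econvex g : Prop :=
  convex_set ([set a | (g a.1 <= (a.2)%:E)%E] : set (E * R^o)).

Definition loc_lipschitz_dom g : Prop :=
  forall x, edom g x ->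
    g x \is a fin_num /\
    exists2 O : set E, nbhs x O &
      [lipschitz (fine (g y) : R^o) | y in O `&` edom g].

Definition subdifferential g x : set E :=
  [set v | g x \is a fin_num /\
           forall y, (g x + (mxdot v (y - x))%:E <= g y)%E].

Definition subderivative g x w : \bar R :=
  limf_einf
    (fun tw : R * E => ((g (x + tw.1 *: tw.2)%R - g x) * (tw.1^-1)%:E)%E)
    (filter_prod 0^'+ (nbhs w)).

Definition second_subderivative g x v w : \bar R :=
  limf_einf
    (fun tw : R * E =>
       ((g (x + tw.1 *: tw.2)%R - g x - (tw.1 * mxdot v tw.2)%:E)
        * ((2^-1 * tw.1 ^+ 2)^-1)%:E)%E)
    (filter_prod 0^'+ (nbhs w)).

Definition critical_cone g x v : set E :=
  [set w | subderivative g x w = (mxdot v w)%:E].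

Definition parabolic_quotient g x w (t : R) z : \bar R :=
  ((g (x + t *: w + (2^-1 * t ^+ 2) *: z)%R - g x - t%:E * subderivative g x w)
   * ((2^-1 * t ^+ 2)^-1)%:E)%E.

Definition parabolic_subderivative g x w z : \bar R :=
  limf_einf (fun tz : R * E => parabolic_quotient g x w tz.1 tz.2)
    (filter_prod 0^'+ (nbhs z)).

Definition parabolically_epi_differentiable g x : Prop :=
  forall w, subderivative g x w \is a fin_num ->
    (exists z, (parabolic_subderivative g x w z < +oo)%E) /\
    (forall z (t : nat -> R), (forall k, 0 < t k) -> t @ \oo --> (0 : R) ->
       exists2 zk : nat -> E, zk @ \oo --> z &
         (fun k => parabolic_quotient g x w (t k) (zk k)) @ \oo
           --> parabolic_subderivative g x w z).

Definition parabolically_regular g x v : Prop :=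
  g x \is a fin_num /\
  forall w, critical_cone g x v w ->
    second_subderivative g x v w =
    ereal_inf [set (parabolic_subderivative g x w z - (mxdot v z)%:E)%E
              | z in [set: E]].

End Variational.

(* Index sets live in 'I_n. A set I of column indices of V is also used, through
   n <= m, for rows of m x n matrices and columns of U. *)
Section IndexSets.
Context {R : realType} {m n : nat}.
Variables (hnm : (n <= m)%N) (X0 : 'M[R]_(m, n)).

Definition alpha : {set 'I_n} := [set s : 'I_n | (s < \rank X0)%N]%SET.
Definition beta : {set 'I_n} := [set s : 'I_n | (\rank X0 <= s)%N]%SET.
Definition beta0 : {set 'I_m} := [set s : 'I_m | (n <= s)%N]%SET.
Definition hbeta : {set 'I_m} :=
  ([set widen_ord hnm s | s in beta] :|: beta0)%SET.

(* The distinct nonzero singular values mu_1 > ... > mu_t. *)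
Definition mus : seq R :=
  undup [seq sigma X0 s 0 | s <- enum 'I_n & sigma X0 s 0 != 0].

Definition alpha_ (mu : R) : {set 'I_n} :=
  [set s in alpha | sigma X0 s 0 == mu]%SET.

Definition idx (I : {set 'I_n}) : 'I_#|I| -> 'I_n := enum_val.
Definition widx (I : {set 'I_n}) : 'I_#|I| -> 'I_m :=
  fun k => widen_ord hnm (enum_val k).

End IndexSets.

Section SecondOrderForm.
Context {R : realType} {m n : nat}.
Variables (hnm : (n <= m)%N) (X0 : 'M[R]_(m, n)).
Variables (U : 'M[R]_m) (V : 'M[R]_n).

Local Notation al := (alpha X0).
Local Notation be := (beta X0).
Local Notation be0 := (@beta0 m n).
Local Notation Ucols I := (colsub (widx hnm (I := I)) U).
Local Notation Vcols I := (colsub (idx (I := I)) V).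

Definition bigB (X : 'M[R]_(m, n)) : 'M[R]_(m + n) := block_mx 0 X X^T 0.

Definition Pcols : nat := #|al| + (#|be| + (#|be0| + (#|al| + #|be|))).

(* Pcols = m + n, but only propositionally. *)
Definition Pmx : 'M[R]_(m + n, Pcols) :=
  (Num.sqrt 2)^-1 *:
  col_mx
    (row_mx (Ucols al) (row_mx (Ucols be)
      (row_mx (Num.sqrt 2 *: colsub (enum_val : 'I_#|be0| -> 'I_m) U)
        (row_mx (- Ucols al) (- Ucols be)))))
    (row_mx (Vcols al) (row_mx (Vcols be)
      (row_mx 0 (row_mx (Vcols al) (Vcols be))))).

(* The columns of P kept in P_I^c. As the first two blocks of P are indexed by
   alpha and beta, column s of P, for s < n, is the one carrying U_s and V_s. *)
Definition Pkeep (I : {set 'I_n}) : {set 'I_Pcols} :=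
  [set j : 'I_Pcols | ~~ [exists s in I, (s : nat) == j]]%SET.

Definition P_ (I : {set 'I_n}) : 'M[R]_(m + n, #|I|) :=
  (Num.sqrt 2)^-1 *: col_mx (Ucols I) (Vcols I).

Definition Pc (I : {set 'I_n}) : 'M[R]_(m + n, #|Pkeep I|) :=
  colsub (enum_val : 'I_#|Pkeep I| -> 'I_Pcols) Pmx.

Definition Lam (I : {set 'I_n}) : 'M[R]_#|Pkeep I| :=
  diag_mx (\row_k (Pmx^T *m bigB X0 *m Pmx) (enum_val k) (enum_val k)).

Definition Sigma_alpha : 'M[R]_#|al| :=
  diag_mx (\row_k sigma X0 (idx k) 0).

Definition alpha_term (Y H : 'M[R]_(m, n)) (mu : R) : R :=
  let I := alpha_ X0 mu in
  mxdot (mxsub (widx hnm (I := I)) (idx (I := I)) (Sigma Y))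
    ((P_ I)^T *m bigB H *m Pc I *m invmx (mu%:M - Lam I)
       *m (Pc I)^T *m bigB H *m P_ I).

Definition beta_term (Y H : 'M[R]_(m, n)) : R :=
  let hb := hbeta hnm X0 in
  let Uhb := colsub (enum_val : 'I_#|hb| -> 'I_m) U in
  mxdot (mxsub (enum_val : 'I_#|hb| -> 'I_m) (idx (I := be)) (Sigma Y))
    (- (Uhb^T *m H *m Vcols al *m invmx Sigma_alpha
          *m (Ucols al)^T *m H *m Vcols be)).

Definition qform (psi : 'M[R]_(m, n) -> R) (f : 'cV[R]_n -> \bar R)
    (Y H : 'M[R]_(m, n)) : \bar R :=
  ((hessian psi X0 H H)%:E
   + second_subderivative f (sigma X0) (sigma Y) (dsigma X0 H)
   + (2 * \sum_(mu <- mus X0) alpha_term Y H mu)%:E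
   + (2 * beta_term Y H)%:E)%E.

End SecondOrderForm.

From mathcomp Require Import complex.

Lemma char_poly_simil (F : fieldType) n (P D : 'M[F]_n) : P \in unitmx ->
  char_poly (invmx P *m D *m P) = char_poly D.
Proof.
move=> Pu; rewrite /char_poly.
have -> : char_poly_mx (invmx P *m D *m P) =
   map_mx polyC (invmx P) *m char_poly_mx D *m map_mx polyC P.
  rewrite /char_poly_mx mulmxBr mulmxBl !map_mxM; congr (_ - _).
  by rewrite scalar_mxC -mulmxA -map_mxM mulVmx// map_mx1 mulmx1.
rewrite !det_mulmx mulrAC -det_mulmx -map_mxM mulVmx// map_mx1 det1 mul1r //.
Qed.

Lemma mxdot_ge0 (R : realType) p q (A : 'M[R]_(p,q)) : 0 <= mxdot A A.
Proof.
rewrite /mxdot /mxtrace; apply: sumr_ge0 => i _; rewrite mxE.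
by apply: sumr_ge0 => j _; rewrite mxE -expr2 sqr_ge0.
Qed.

Lemma mxdot_eq0 (R : realType) p q (A : 'M[R]_(p,q)) : mxdot A A = 0 -> A = 0.
Proof.
have H i : 0 <= (A^T *m A) i i.
  by rewrite mxE; apply: sumr_ge0 => j _; rewrite mxE -expr2 sqr_ge0.
move=> /(psumr_eq0P (fun i _ => H i)) A0; apply/matrixP => i j; rewrite mxE.
have := A0 j isT; rewrite mxE => /psumr_eq0P => /(_ _ i isT).
rewrite mxE -expr2 => h; apply/eqP; rewrite -sqrf_eq0; apply/eqP/h => k _.
by rewrite mxE -expr2 sqr_ge0.
Qed.

Lemma is_singular_values_exists (R : realType) m n (X : 'M[R]_(m, n)) :
  exists s, is_singular_values X s.
Proof.
set A := X^T *m X.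
pose Ac : 'M[R[i]]_n := map_mx (real_complex R) A.
have Ah : Ac \is hermsymmx.
  apply: realsym_hermsym.
    have As : A^T = A by rewrite /A trmx_mul trmxK.
    by apply/is_hermitianmxP; rewrite expr0 scale1r map_mx_id // /Ac map_trmx As.
  by apply/mxOverP => i j; rewrite mxE; apply/complex_realP; exists (A i j).
have /hermitian_normalmx/orthomx_spectralP E := Ah.
have spr := hermitian_spectral_diag_real Ah.
set sp := spectral_diag Ac in E spr.
have [k kE] : exists k : 'I_n -> R, forall i, sp 0 i = real_complex R (k i).
  exists (fun i => complex.Re (sp 0 i)) => i.
  have /complex_realP[k ->] // : sp 0 i \is Num.real.
  by move/mxOverP: spr; apply.
have cA : char_poly A = \prod_i ('X - (k i)%:P).
  apply: (map_inj_poly (@complexI R) (rmorph0 _)).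
  rewrite map_char_poly -/Ac E char_poly_simil ?spectral_unit//.
  rewrite char_poly_trig ?diag_mx_is_trig// rmorph_prod/=.
  by apply: eq_bigr => i _; rewrite map_polyXsubC !mxE eqxx mulr1n kE.
have k0 i : 0 <= k i.
  have : root (char_poly A) (k i).
    by rewrite cA; apply/rootP; rewrite horner_prod (bigD1 i)//= !hornerE subrr mul0r.
  rewrite -eigenvalue_root_char => /eigenvalueP[v vA v0].
  have : mxdot (X *m v^T) (X *m v^T) = k i * mxdot v^T v^T.
    rewrite /mxdot trmx_mul !trmxK mulmxA -[v *m _ *m _]mulmxA vA -scalemxAl mxtraceZ //.
  have := mxdot_ge0 (X *m v^T) => + h; rewrite h => h2.
  rewrite -(pmulr_lge0 _ (x := mxdot v^T v^T))// lt_neqAle mxdot_ge0 andbT eq_sym.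
  by apply: contra v0 => /eqP/mxdot_eq0 /(congr1 trmx); rewrite trmxK trmx0 => ->.
pose l := sort (>=%R) [seq Num.sqrt (k i) | i <- enum 'I_n].
have sl : size l = n by rewrite size_sort size_map size_enum_ord.
exists (\col_i nth 0 l i); split.
- move=> i; rewrite mxE.
  have : nth 0 l i \in l by rewrite mem_nth// sl.
  by rewrite mem_sort => /mapP[j _ ->]; exact: sqrtr_ge0.
- move=> i j ij; rewrite !mxE.
  have ls : sorted (>=%R) l by apply: sort_sorted => x y; exact: (le_total y x).
  have gt : transitive (>=%R : rel R) by move=> x y z xy yz; exact: le_trans yz xy.
  have gr : reflexive (>=%R : rel R) by move=> x; exact: lexx.
  by apply: (sorted_leq_nth gt gr 0 ls) => //; rewrite ?inE ?sl.
rewrite -/A cA.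
under [RHS]eq_bigr do rewrite mxE.
transitivity (\prod_(x <- [seq Num.sqrt (k i) | i <- enum 'I_n]) ('X - (x ^+ 2)%:P)).
  by rewrite big_map big_enum; apply: eq_bigr => i _; rewrite sqr_sqrtr.
rewrite (perm_big l) /=; last by rewrite perm_sym perm_sort.
by rewrite (big_nth 0) sl big_mkord.
Qed.

Lemma is_singular_values_uniq (R : realType) m n (X : 'M[R]_(m, n)) s s' :
  is_singular_values X s -> is_singular_values X s' -> s = s'.
Proof.
move=> [p1 d1 c1] [p2 d2 c2].
pose t (u : 'cV[R]_n) := [seq u i 0 ^+ 2 | i <- enum 'I_n].
have P : perm_eq (t s) (t s').
  have T u : \prod_(x <- t u) ('X - x%:P) = \prod_i ('X - (u i 0 ^+ 2)%:P) by rewrite big_map big_enum.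
  by apply: prod_XsubC_eq; rewrite !T -c1 -c2.
have S (u : 'cV[R]_n) : (forall i, 0 <= u i 0) -> (forall i j : 'I_n, (i <= j)%N -> u j 0 <= u i 0) ->
   sorted >=%R (t u).
  move=> pu du; apply: (homo_sorted_in (e:=relpre val leq) (P := predT)).
  - by move=> i j _ _ /= ij; rewrite lerXn2r ?nnegrE ?pu ?du.
  - by apply/allP.
  - by rewrite -sorted_map val_enum_ord iota_sorted.
have : t s = t s'.
  by apply: (sorted_eq (leT := >=%R)); [exact: ge_trans | exact: ge_anti | exact: S | exact: S | ].
move=> /eq_in_map h; apply/colP => i.
by apply/eqP; rewrite -(@eqrXn2 _ 2) ?p1 ?p2 // h ?mem_enum.
Qed.

Lemma sigmaP (R : realType) m n (X : 'M[R]_(m, n)) : is_singular_values X (sigma X).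
Proof. by have [s h] := is_singular_values_exists X; rewrite /sigma; case: xgetP => [? -> //|] /(_ s). Qed.

(* Main.v *)
Require Import Defs.
From HB Require Import structures.
From mathcomp Require Import all_boot all_order all_algebra all_fingroup.
From mathcomp Require Import all_classical all_reals all_analysis.
From mathcomp Require Import ring lra.

(** Both assertions are the classical second-order conditions for a sum psi + g: the
    sign of hessian psi (H, H) + d2 g (X0 | Y) (H) on the critical cone, necessary for
    a local minimum and, when strict, equivalent to quadratic growth
    (second_order_necessary, second_order_sufficient, growth_second_order). They need
    the Peano expansion of psi along convergent directions (taylor2), the definition
    of the second subderivative as a lower limit, the inequality
    <Y, H> <= dg (X0) (H) for non-critical directions, and compactness of the unit
    sphere. What remains is to show that for g = f o sigma and H critical the second
    subderivative is
      d2 f (sigma X0 | sigma Y) (sigma' (X0; H))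
    plus the alpha and beta terms of the quadratic form.

    Write X0 = U D_x V^T and Y = U D_y V^T. If H = U (D_d + A D_x + D_x B) V^T with A
    and B skew-symmetric, then to first order H moves the singular values by d and
    rotates the frames with velocities A and B. Rotations are realized by Cayley
    transforms, which are exactly orthogonal and have an elementary second-order
    expansion (spin_expansion2). Along the curves that move the diagonal and rotate
    the frames, f o sigma reduces to f, by absolute symmetry, while the linear term
    <Y, .> picks up a second-order correction, minus half the frame curvature
      - <D_y, A A D_x + D_x B B + 2 A D_x B>;
    this bounds the second subderivative from above
    (second_subderivative_sigma_le). Conversely, rotating back an arbitrary matrix
    near X0 + t H and applying von Neumann's trace inequality gives the same bound
    from below (second_subderivative_sigma_ge). The two bounds together give the chain
    rule for the second subderivative directly.

    Such a decomposition of H in frames common to X0 and Y exists because H is critical.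
    The subdifferential of f o sigma at X0 is invariant under the stabilizer of X0, so
    among the rotated copies of Y the matrix Y itself has the largest pairing with H.
    Maximizing first this pairing and then, within the stabilizer of both X0 and
    Y, the pairing with a diagonal matrix of distinct positive entries, the
    first-order conditions put H in a form that is diagonal on each block of equal
    singular values (adapted_frame), and for this form A, B and d are found by
    solving a 2 x 2 system for each pair of indices (adapted_decomposition). The same
    compactness argument with X0 = 0 yields the singular value decomposition and
    von Neumann's inequality.

    The adapted frames need not be the given pair (U, V). Rotated back to (U, V), the
    diagonal part D_d becomes a matrix D with D D_x^T and D_x^T D symmetric
    (critical_expansion). Expanding the resolvents in the columns of P shows that the
    alpha and beta terms are sums over pairs of indices of squares of entries of
    U^T H V, in which D cancels and the frame curvature remains
    (explicit_frame_curvature). *)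

Set Implicit Arguments.
Unset Strict Implicit.
Unset Printing Implicit Defensive.

Import Order.TTheory GRing.Theory Num.Theory.
Import numFieldNormedType.Exports.

Local Open Scope classical_set_scope.
Local Open Scope ring_scope.

(** * Inner product, norm and limits of matrices *)

Section InnerProduct.
Context {R : realType}.

Lemma mxdotE p q (A B : 'M[R]_(p, q)) :
  mxdot A B = \sum_i \sum_j A i j * B i j.
Proof.
rewrite /mxdot /mxtrace exchange_big /=; apply: eq_bigr => j _.
by rewrite mxE; apply: eq_bigr => i _; rewrite mxE.
Qed.

Lemma mxdotC p q (A B : 'M[R]_(p, q)) : mxdot A B = mxdot B A.
Proof. by rewrite /mxdot -mxtrace_tr trmx_mul trmxK. Qed.

Lemma mxdotDr p q (A B C : 'M[R]_(p, q)) :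
  mxdot A (B + C) = mxdot A B + mxdot A C.
Proof. by rewrite /mxdot mulmxDr raddfD. Qed.

Lemma mxdotNr p q (A B : 'M[R]_(p, q)) : mxdot A (- B) = - mxdot A B.
Proof. by rewrite /mxdot mulmxN raddfN. Qed.

Lemma mxdotBr p q (A B C : 'M[R]_(p, q)) :
  mxdot A (B - C) = mxdot A B - mxdot A C.
Proof. by rewrite mxdotDr mxdotNr. Qed.

Lemma mxdotZr p q (a : R) (A B : 'M[R]_(p, q)) :
  mxdot A (a *: B) = a * mxdot A B.
Proof. by rewrite /mxdot -scalemxAr mxtraceZ. Qed.

Lemma mxdotDl p q (A B C : 'M[R]_(p, q)) :
  mxdot (B + C) A = mxdot B A + mxdot C A.
Proof. by rewrite mxdotC mxdotDr !(mxdotC A). Qed.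

Lemma mxdotNl p q (A B : 'M[R]_(p, q)) : mxdot (- A) B = - mxdot A B.
Proof. by rewrite mxdotC mxdotNr mxdotC. Qed.

Lemma mxdotBl p q (A B C : 'M[R]_(p, q)) :
  mxdot (B - C) A = mxdot B A - mxdot C A.
Proof. by rewrite mxdotDl mxdotNl. Qed.

Lemma mxdotZl p q (a : R) (A B : 'M[R]_(p, q)) :
  mxdot (a *: A) B = a * mxdot A B.
Proof. by rewrite mxdotC mxdotZr mxdotC. Qed.

Lemma mxdot0r p q (A : 'M[R]_(p, q)) : mxdot A 0 = 0.
Proof. by rewrite /mxdot mulmx0 mxtrace0. Qed.

Lemma mxdot_mull p q k (A : 'M[R]_(p, k)) B (C : 'M[R]_(p, q)) :
  mxdot (A *m B) C = mxdot B (A^T *m C).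
Proof. by rewrite /mxdot trmx_mul mulmxA. Qed.

Lemma mxdot_mulr p q k (A : 'M[R]_(p, k)) B (C : 'M[R]_(p, q)) :
  mxdot (A *m B) C = mxdot A (C *m B^T).
Proof. by rewrite /mxdot trmx_mul -mulmxA mxtrace_mulC mulmxA. Qed.

Lemma mxdot_tr p q (A B : 'M[R]_(p, q)) : mxdot A^T B^T = mxdot A B.
Proof. by rewrite mxdotC /mxdot trmxK mxtrace_mulC. Qed.

Lemma mxdot_delta p q (A : 'M[R]_(p, q)) i j : mxdot A (delta_mx i j) = A i j.
Proof.
rewrite mxdotE (bigD1 i) //= (bigD1 j) //= mxE !eqxx mulr1 big1 ?addr0.
  by rewrite big1 ?addr0// => k ki; apply: big1 => l _; rewrite mxE (negPf ki) mulr0.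
by move=> k kj; rewrite mxE (negPf kj) andbF mulr0.
Qed.

Lemma mxdot_skew p (A B : 'M[R]_p) : A^T = A -> B^T = - B -> mxdot A B = 0.
Proof.
move=> As Bs; apply/eqP; rewrite -[_ == 0](@mulrn_eq0 R _ 2)//.
by rewrite mulr2n -{1}(mxdot_tr A B) As Bs mxdotNr addNr.
Qed.

Lemma sqr_frobenius p q (A : 'M[R]_(p, q)) : frobenius A ^+ 2 = mxdot A A.
Proof. by rewrite sqr_sqrtr// mxdot_ge0. Qed.

Lemma frobenius_ge0 p q (A : 'M[R]_(p, q)) : 0 <= frobenius A.
Proof. exact: sqrtr_ge0. Qed.

Lemma frobeniusZ p q (a : R) (A : 'M[R]_(p, q)) :
  frobenius (a *: A) = `|a| * frobenius A.
Proof.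
by rewrite /frobenius mxdotZl mxdotZr mulrA -expr2 sqrtrM ?sqr_ge0// sqrtr_sqr.
Qed.

Lemma frobenius_eq0 p q (A : 'M[R]_(p, q)) : frobenius A = 0 -> A = 0.
Proof. by move=> A0; apply: mxdot_eq0; rewrite -sqr_frobenius A0 expr0n. Qed.

Lemma entry_le_frobenius p q (A : 'M[R]_(p, q)) i j : `|A i j| <= frobenius A.
Proof.
rewrite -sqrtr_sqr ler_sqrt ?mxdot_ge0// mxdotE (bigD1 i) //= (bigD1 j) //= -expr2.
rewrite -addrA lerDl addr_ge0 //; apply: sumr_ge0 => k _; rewrite -?expr2 ?sqr_ge0//.
by apply: sumr_ge0 => l _; rewrite -expr2 sqr_ge0.
Qed.

Lemma mx_norm_le_frobenius p q (A : 'M[R]_(p, q)) : `|A| <= frobenius A.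
Proof.
rewrite [`|A|]/Num.norm /= mx_normrE; apply/bigmax_leP; split => [|[i j] _ /=].
  exact: frobenius_ge0.
exact: entry_le_frobenius.
Qed.

Lemma entry_le_mx_norm p q (A : 'M[R]_(p, q)) i j : `|A i j| <= `|A|.
Proof.
by rewrite [leRHS]/Num.norm /= mx_normrE; apply/bigmax_geP; right => /=; exists (i, j).
Qed.

End InnerProduct.

Section MatrixLimits.
Context {R : realType} {T : Type} {F : set_system T} {FF : Filter F}.

Lemma cvg_mx_entries p q (f : T -> 'M[R]_(p, q)) (M : 'M[R]_(p, q)) :
  (forall i j, (fun a => f a i j) @ F --> M i j) -> f @ F --> M.
Proof.
move=> fM A [P MP PA].
have : \forall a \near F, forall ij : 'I_p * 'I_q, P ij.1 ij.2 (f a ij.1 ij.2).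
  by apply: filter_forall => -[i j] /=; exact: fM (MP i j).
by apply: filterS => a Pa; apply: PA => i j; exact: (Pa (i, j)).
Qed.

Lemma cvg_entry p q (f : T -> 'M[R]_(p, q)) (M : 'M[R]_(p, q)) i j :
  f @ F --> M -> (fun a => f a i j) @ F --> M i j.
Proof. by move=> fM; exact: (cvg_comp f _ fM (@coord_continuous R p q i j M)). Qed.

Lemma cvg_sumr (I : Type) (r : seq I) (f : I -> T -> R) (l : I -> R) :
  (forall i, f i @ F --> l i) ->
  (fun a => \sum_(i <- r) f i a) @ F --> \sum_(i <- r) l i.
Proof.
move=> fl; apply: cvg_big => // -[x y].
exact: add_continuous.
Qed.

Lemma cvg_mulmx p q k (f : T -> 'M[R]_(p, q)) (g : T -> 'M[R]_(q, k))
    (A : 'M[R]_(p, q)) (B : 'M[R]_(q, k)) :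
  f @ F --> A -> g @ F --> B -> (fun a => f a *m g a) @ F --> A *m B.
Proof.
move=> fA gB; apply: cvg_mx_entries => i j.
under eq_fun do rewrite mxE.
by rewrite mxE; apply: cvg_sumr => l; by apply: cvgM; exact: cvg_entry.
Qed.

Lemma cvg_mxdot p q (f g : T -> 'M[R]_(p, q)) (A B : 'M[R]_(p, q)) :
  f @ F --> A -> g @ F --> B -> (fun a => mxdot (f a) (g a)) @ F --> mxdot A B.
Proof.
move=> fA gB.
under eq_fun do rewrite mxdotE.
rewrite mxdotE; apply: cvg_sumr => i; apply: cvg_sumr => j; by apply: cvgM; exact: cvg_entry.
Qed.

End MatrixLimits.

Section MatrixContinuity.
Context {R : realType} {T : topologicalType}.

Lemma continuous_mx_entries p q (f : T -> 'M[R]_(p, q)) :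
  (forall i j, continuous (fun z => f z i j)) -> continuous f.
Proof.
move=> fc z; apply: (@cvg_mx_entries R T (nbhs z) (nbhs_filter z)) => i j.
exact: fc.
Qed.

Lemma continuous_mulmx p q k (f : T -> 'M[R]_(p, q)) (g : T -> 'M[R]_(q, k)) :
  continuous f -> continuous g -> continuous (fun z => f z *m g z).
Proof.
by move=> fc gc z; apply: (@cvg_mulmx R T (nbhs z) (nbhs_filter z)); [exact: fc|exact: gc].
Qed.

Lemma continuous_trmx p q (f : T -> 'M[R]_(p, q)) :
  continuous f -> continuous (fun z => (f z)^T).
Proof.
move=> fc; apply: continuous_mx_entries => i j z.
under eq_fun do rewrite mxE.
exact: (@cvg_entry R T (nbhs z) p q f (f z) j i (fc z)).
Qed.

Lemma continuous_mxdot p q (f g : T -> 'M[R]_(p, q)) :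
  continuous f -> continuous g -> continuous (fun z => mxdot (f z) (g z)).
Proof.
by move=> fc gc z; apply: (@cvg_mxdot R T (nbhs z) (nbhs_filter z)); [exact: fc|exact: gc].
Qed.

End MatrixContinuity.

(** * Compactness of the orthogonal group *)

Section OrthogonalCompactness.
Context {R : realType}.

(** Heine-Borel for matrices, transported from row vectors along vec_mx. *)
Lemma bounded_closed_compact_mx p q (A : set 'M[R]_(p, q)) (M : R) :
  (forall X, A X -> forall i j, `|X i j| <= M) -> closed A -> compact A.
Proof.
move=> AM Acl.
have vc : continuous (@vec_mx R p q).
  apply: continuous_mx_entries => i j v.
  have -> : (fun z : 'rV[R]_(p * q) => vec_mx z i j) = (fun z => z 0 (mxvec_index i j)).
    by apply/funext => z; rewrite mxE.
  exact: coord_continuous.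
have -> : A = vec_mx @` (vec_mx @^-1` A).
  apply/seteqP; split=> [X AX|_ [v Av <-]//].
  by exists (mxvec X); rewrite /= mxvecK.
apply: continuous_compact; first exact: continuous_subspaceT.
apply: bounded_closed_compact; last exact: closed_comp (fun v _ => vc v) Acl.
exists `|M|; split; first exact: num_real.
move=> N MN v Av; change (`|v| <= N); rewrite [leLHS]/Num.norm /= mx_normrE.
have N0 : 0 <= N by rewrite (le_trans _ (ltW MN)).
apply/bigmax_leP; split => // -[i k] _ /=.
rewrite ord1; case/mxvec_indexP: k => a b.
have := AM _ Av a b; rewrite mxE => /le_trans; apply.
by rewrite (le_trans (ler_norm _) (ltW MN)).
Qed.

Lemma closed_eq_mx (T : topologicalType) p q (f g : T -> 'M[R]_(p, q)) :
  continuous f -> continuous g -> closed [set z | f z = g z].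
Proof.
move=> fc gc.
have -> : [set z | f z = g z] = (fun z => f z - g z) @^-1` [set 0].
  apply/seteqP; split=> z /=; first by move=> ->; rewrite subrr.
  by move/eqP; rewrite subr_eq0 => /eqP.
apply: closed_comp => [z _|]; first by apply: cvgB; [exact: fc|exact: gc].
exact/accessible_closed_set1/hausdorff_accessible/norm_hausdorff.
Qed.

Lemma orthogonal_mxC p (Q : 'M[R]_p) : orthogonal_mx Q -> Q *m Q^T = 1%:M.
Proof. exact: mulmx1C. Qed.

Lemma orthogonal_mx1 p : orthogonal_mx (1%:M : 'M[R]_p).
Proof. by rewrite /orthogonal_mx trmx1 mulmx1. Qed.

Lemma orthogonal_mxT p (Q : 'M[R]_p) : orthogonal_mx Q -> orthogonal_mx Q^T.
Proof. by move=> Qo; rewrite /orthogonal_mx trmxK; exact: orthogonal_mxC. Qed.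

Lemma orthogonal_mxM p (Q Q' : 'M[R]_p) :
  orthogonal_mx Q -> orthogonal_mx Q' -> orthogonal_mx (Q *m Q').
Proof.
by move=> Qo Qo'; rewrite /orthogonal_mx trmx_mul mulmxA -(mulmxA _ Q^T) Qo mulmx1.
Qed.

Lemma mxdot_orth p q (Q1 : 'M[R]_p) (Q2 : 'M[R]_q) (A B : 'M[R]_(p, q)) :
  orthogonal_mx Q1 -> orthogonal_mx Q2 ->
  mxdot (Q1 *m A *m Q2^T) (Q1 *m B *m Q2^T) = mxdot A B.
Proof.
move=> o1 o2; rewrite mxdot_mulr trmxK -mulmxA o2 mulmx1.
by rewrite mxdot_mull !mulmxA o1 mul1mx.
Qed.

Lemma orthogonal_entry_le1 p (Q : 'M[R]_p) i j : orthogonal_mx Q -> `|Q i j| <= 1.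
Proof.
move=> Qo; have := congr1 (fun M : 'M[R]_p => M j j) Qo.
rewrite !mxE eqxx /= (bigD1 i)//= mxE -expr2 => Q1.
rewrite -(@ler_pXn2r _ 2)// ?nnegrE// expr1n -normrX ger0_norm ?sqr_ge0// -[leRHS]Q1 lerDl.
by apply: sumr_ge0 => k _; rewrite mxE -expr2 sqr_ge0.
Qed.

Lemma compact_orthogonal p : compact [set Q : 'M[R]_p | orthogonal_mx Q].
Proof.
apply: (@bounded_closed_compact_mx _ _ _ 1) => [Q Qo i j|].
  exact: orthogonal_entry_le1.
apply: (@closed_eq_mx 'M[R]_p p p (fun Q => Q^T *m Q) (fun=> 1%:M)); last first.
  exact: cst_continuous.
have idc : continuous (fun Q : 'M[R]_p => Q) by move=> Q; exact: cvg_id.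
by apply: continuous_mulmx => //; exact: (continuous_trmx idc).
Qed.

End OrthogonalCompactness.

(** * Rotations by the Cayley transform *)

Section Cayley.
Context {R : realType}.

Definition cayley p (K : 'M[R]_p) : 'M[R]_p := invmx (1%:M - K) *m (1%:M + K).

Definition skewsym p (K : 'M[R]_p) : Prop := K^T = - K.

Lemma skewsymN p (K : 'M[R]_p) : skewsym K -> skewsym (- K).
Proof. by rewrite /skewsym => Ks; rewrite linearN /= Ks. Qed.

Lemma skewsymZ p (a : R) (K : 'M[R]_p) : skewsym K -> skewsym (a *: K).
Proof. by rewrite /skewsym => Ks; rewrite linearZ /= Ks scalerN. Qed.

(** A kernel vector v of 1 - K satisfies v = v K, and v is orthogonal to v K. *)
Lemma skewsym_sub1_unit p (K : 'M[R]_p) : skewsym K -> 1%:M - K \in unitmx.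
Proof.
move=> Ks; rewrite -row_free_unit; apply/row_freeP.
have : kermx (1%:M - K) = 0.
  apply/eqP; rewrite -submx0; apply/rV_subP => v /sub_kermxP.
  rewrite mulmxBr mulmx1 => /eqP; rewrite subr_eq0 => /eqP vK.
  have : mxdot v v = 0.
    apply/eqP; rewrite -[_ == 0](@mulrn_eq0 R _ 2)// mulr2n.
    have : mxdot v (v *m K) = - mxdot v (v *m K).
      by rewrite {1}mxdotC mxdot_mulr Ks mulmxN mxdotNr.
    by rewrite -vK => {1}->; rewrite addNr.
  by move/mxdot_eq0 => ->; rewrite sub0mx.
move=> k0; exists (invmx (1%:M - K)); apply: mulmxV.
by rewrite -row_free_unit -kermx_eq0 k0.
Qed.

Lemma cayley_intertwine p q (K : 'M[R]_p) (L : 'M[R]_q) (D : 'M[R]_(p, q)) :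
  skewsym K -> skewsym L -> K *m D = D *m L -> cayley K *m D = D *m cayley L.
Proof.
move=> Ks Ls KD; apply: (can_inj (mulKmx (skewsym_sub1_unit Ks))).
rewrite mulmxA mulKVmx ?skewsym_sub1_unit// mulmxDl mul1mx KD.
by rewrite [RHS]mulmxA mulmxBl mul1mx KD -[D in D - _]mulmx1 -mulmxBr -mulmxA
  mulKVmx ?skewsym_sub1_unit// mulmxDr mulmx1.
Qed.

Lemma sub1_add1_comm p (K : 'M[R]_p) :
  (1%:M + K) *m (1%:M - K) = (1%:M - K) *m (1%:M + K).
Proof.
rewrite mulmxDl mulmxBl !mulmxBr !mulmxDr !mul1mx !mulmx1.
by rewrite addrA subrK opprD addrA addrK.
Qed.

Lemma cayley_mulr p (K : 'M[R]_p) : skewsym K ->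
  cayley K = (1%:M + K) *m invmx (1%:M - K).
Proof.
move=> Ks; have u := skewsym_sub1_unit Ks.
apply: (can_inj (mulmxK u)); rewrite mulmxKV// /cayley -mulmxA.
apply: (can_inj (mulKmx u)); rewrite mulKVmx//.
exact: sub1_add1_comm.
Qed.

Lemma trmx_cayley p (K : 'M[R]_p) : skewsym K -> (cayley K)^T = cayley (- K).
Proof.
move=> Ks; rewrite (cayley_mulr (skewsymN Ks)) /cayley trmx_mul trmx_inv.
by rewrite !linearD /= linearN /= trmx1 Ks opprK.
Qed.

Lemma cayley_orthogonal p (K : 'M[R]_p) : skewsym K -> orthogonal_mx (cayley K).
Proof.
move=> Ks; rewrite /orthogonal_mx trmx_cayley// (cayley_mulr Ks) /cayley opprK.
have u := skewsym_sub1_unit Ks; have u' := skewsym_sub1_unit (skewsymN Ks).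
rewrite opprK in u'.
by rewrite mulmxA -(mulmxA _ (1%:M - K)) -sub1_add1_comm !mulmxA mulVmx// mul1mx mulmxV.
Qed.

(** Iterating this fixed-point form gives the Taylor expansion of the Cayley
    transform at 0 with a remainder controlled by the entries of an orthogonal
    matrix. *)
Lemma cayley_fixpoint p (K : 'M[R]_p) : skewsym K ->
  cayley K = 1%:M + K *m (1%:M + cayley K).
Proof.
move=> Ks; have u := skewsym_sub1_unit Ks.
have : (1%:M - K) *m cayley K = 1%:M + K by rewrite mulKVmx.
rewrite mulmxBl mul1mx mulmxDr mulmx1 addrA => /eqP.
by rewrite subr_eq => /eqP.
Qed.

(** Since the Cayley transform has derivative 2 at 0, halving t makes the orthogonal
    curve t |-> spin A t have velocity A at t = 0. *)
Definition spin p (A : 'M[R]_p) (t : R) : 'M[R]_p := cayley ((t / 2) *: A).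

(** The chord slope (spin A t - 1) / t. *)
Definition spin_slope p (A : 'M[R]_p) (t : R) : 'M[R]_p :=
  2^-1 *: (A *m (1%:M + spin A t)).

Lemma spin_orthogonal p (A : 'M[R]_p) t : skewsym A -> orthogonal_mx (spin A t).
Proof. by move=> As; apply/cayley_orthogonal/skewsymZ. Qed.

Lemma spinN p (A : 'M[R]_p) t : skewsym A -> spin (- A) t = (spin A t)^T.
Proof. by move=> As; rewrite /spin trmx_cayley ?scalerN//; exact: skewsymZ. Qed.

Lemma spin_oppr p (A : 'M[R]_p) t : spin (- A) t = spin A (- t).
Proof. by rewrite /spin scalerN -scaleNr mulNr. Qed.

Lemma spinE p (A : 'M[R]_p) t : skewsym A -> spin A t = 1%:M + t *: spin_slope A t.
Proof.
move=> As; rewrite {1}/spin cayley_fixpoint; last exact: skewsymZ.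
by rewrite -/(spin A t) /spin_slope scalerA -scalemxAl.
Qed.

Lemma spin_slopeE p (A : 'M[R]_p) t : skewsym A ->
  spin_slope A t = A + t *: (2^-1 *: (A *m spin_slope A t)).
Proof.
move=> As; rewrite {1}/spin_slope spinE//.
have -> : 1%:M + (1%:M + t *: spin_slope A t) = 2 *: 1%:M + t *: spin_slope A t.
  by rewrite addrA -mulr2n scaler_nat.
rewrite mulmxDr -(scalemxAr 2) -(scalemxAr t) mulmx1 scalerDr.
by rewrite !scalerA mulVf ?pnatr_eq0// scale1r mulrC.
Qed.

Lemma spin_intertwine p q (A : 'M[R]_p) (B : 'M[R]_q) (D : 'M[R]_(p, q)) t :
  skewsym A -> skewsym B -> A *m D = D *m B -> spin A t *m D = D *m spin B t.
Proof.
move=> As Bs AD; apply: cayley_intertwine; rewrite -?scalemxAl ?AD ?scalemxAr//;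
  exact: skewsymZ.
Qed.

Lemma spin_slope_le p (A : 'M[R]_p) t i j : skewsym A ->
  `|spin_slope A t i j| <= \sum_k `|A i k|.
Proof.
move=> As; rewrite !mxE normrM ger0_norm ?invr_ge0// ler_pdivrMl//.
rewrite mulr_sumr (le_trans (ler_norm_sum _ _ _))//; apply: ler_sum => k _.
rewrite normrM mulrC ler_wpM2r// mxE (le_trans (ler_normD _ _))//.
rewrite -[2]/(1 + 1) lerD// orthogonal_entry_le1//; last exact: spin_orthogonal.
exact: orthogonal_mx1.
Qed.

End Cayley.

Section Expansion.
Context {R : realType}.

Lemma mul_perturbation p q (N : 'M[R]_p) (N' : 'M[R]_q) (X W : 'M[R]_(p, q)) t :
  (1%:M + t *: N) *m (X + t *: W) *m (1%:M + t *: N') =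
  X + t *: (W + N *m X + X *m N') + t ^+ 2 *: (N *m W + W *m N' + N *m X *m N')
  + t ^+ 3 *: (N *m W *m N').
Proof.
rewrite !(mulmxDl, mulmxDr, mul1mx, mulmx1) -!(scalemxAl, scalemxAr) -?scalemxAl.
move: (N *m X *m N') (N *m W *m N') => a1 a2.
move: (N *m X) (X *m N') (N *m W) (W *m N') => a3 a4 a5 a6.
by apply/matrixP => i j; rewrite !mxE; ring.
Qed.

End Expansion.

Section CayleyLimits.
Context {R : realType} {T : Type} {F : set_system T} {FF : Filter F}.
Variable tau : T -> R.
Hypothesis tau0 : tau @ F --> (0 : R).

Lemma cvg0_mul_bounded (g : T -> R) b :
  (forall a, `|g a| <= b) -> (fun a => tau a * g a) @ F --> (0 : R).
Proof.
move=> gb; apply: norm_cvg0.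
apply: (@squeeze_cvgr _ _ _ _ (cst 0) (fun a => `|tau a| * b)).
- by near=> a; rewrite normr_ge0 /= normrM ler_wpM2l.
- exact: cvg_cst.
- rewrite -(mul0r b); apply: cvgMl; rewrite -(normr0 R); exact: cvg_norm.
Unshelve. all: by end_near. Qed.

Lemma spin_slope_cvg p (A : 'M[R]_p) : skewsym A ->
  (fun a => spin_slope A (tau a)) @ F --> A.
Proof.
move=> As; apply: cvg_mx_entries => i j.
have -> : (fun a => spin_slope A (tau a) i j) = (fun a => A i j +
    tau a * (2^-1 * (A *m spin_slope A (tau a)) i j)).
  by apply/funext => a; rewrite {1}spin_slopeE// !mxE.
rewrite -[X in _ --> X]addr0; apply: cvgD; first exact: cvg_cst.
apply: (@cvg0_mul_bounded _ (2^-1 * \sum_k (`|A i k| * \sum_l `|A k l|))) => a.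
rewrite normrM ger0_norm ?invr_ge0// ler_wpM2l ?invr_ge0// mxE.
rewrite (le_trans (ler_norm_sum _ _ _))//; apply: ler_sum => k _.
by rewrite normrM ler_wpM2l// spin_slope_le.
Qed.

Variables (p q : nat) (A : 'M[R]_p) (B : 'M[R]_q) (X W0 : 'M[R]_(p, q)).
Variable W : T -> 'M[R]_(p, q).
Hypotheses (As : skewsym A) (Bs : skewsym B) (W_cvg : W @ F --> W0).
Hypothesis tau_neq0 : \forall a \near F, tau a != 0.

(** Second-order expansion of a matrix moving in a rotating frame. The velocity W a
    may vary with the point a of the filter, because the difference quotients of
    second subderivatives perturb the direction as well as the step. *)
Lemma spin_expansion2 :
  (fun a => (tau a ^+ 2)^-1 *: (spin A (tau a) *m (X + tau a *: W a) *m spin B (tau a)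
     - X - tau a *: (W a + A *m X + X *m B))) @ F -->
  2^-1 *: (A *m A *m X) + 2^-1 *: (X *m (B *m B)) + (A *m W0 + W0 *m B + A *m X *m B).
Proof.
pose N a := spin_slope A (tau a); pose N' a := spin_slope B (tau a).
have NA : N @ F --> A by exact: spin_slope_cvg.
have NB : N' @ F --> B by exact: spin_slope_cvg.
pose G a := 2^-1 *: (A *m N a *m X) + 2^-1 *: (X *m (B *m N' a))
  + (N a *m W a + W a *m N' a + N a *m X *m N' a) + tau a *: (N a *m W a *m N' a).
have cA : (fun=> A) @ F --> A by exact: cvg_cst.
have cB : (fun=> B) @ F --> B by exact: cvg_cst.
have cX : (fun=> X) @ F --> X by exact: cvg_cst.
have GL : G @ F --> 2^-1 *: (A *m A *m X) + 2^-1 *: (X *m (B *m B))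
    + (A *m W0 + W0 *m B + A *m X *m B) + 0 *: (A *m W0 *m B).
  rewrite /G; apply: cvgD; last first.
    by apply: cvgZ => //; do 2![apply: cvg_mulmx => //].
  apply: cvgD; last by repeat apply: cvgD; repeat apply: cvg_mulmx.
  by apply: cvgD; apply: cvgZr; repeat apply: cvg_mulmx.
rewrite scale0r addr0 in GL; apply: cvg_trans GL.
apply: near_eq_cvg; near=> a.
have t0 : tau a != 0 by near: a.
rewrite !spinE// -/(N a) -/(N' a) mul_perturbation.
rewrite /G; move: (N a *m X *m N' a) (N a *m W a *m N' a) => a1 a2.
move: (N a *m W a) (W a *m N' a) => a3 a4.
have -> : N a *m X = A *m X + tau a *: (2^-1 *: (A *m N a *m X)).
  by rewrite {1}/N spin_slopeE// mulmxDl -!scalemxAl.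
have -> : X *m N' a = X *m B + tau a *: (2^-1 *: (X *m (B *m N' a))).
  by rewrite {1}/N' spin_slopeE// mulmxDr -!scalemxAr.
move: (A *m N a *m X) (X *m (B *m N' a)) (A *m X) (X *m B) (W a) => a5 a6 a7 a8 a9.
apply/matrixP => i j; rewrite !mxE; field; rewrite ?t0//.
Unshelve. all: by end_near. Qed.

Lemma spin_expansion1 :
  (fun a => (tau a)^-1 *: (spin A (tau a) *m (X + tau a *: W a) *m spin B (tau a) - X))
    @ F --> W0 + A *m X + X *m B.
Proof.
pose G a := (tau a ^+ 2)^-1 *: (spin A (tau a) *m (X + tau a *: W a) *m spin B (tau a)
     - X - tau a *: (W a + A *m X + X *m B)).
have : (fun a => tau a *: G a + (W a + A *m X + X *m B)) @ F --> 0 *: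
   (2^-1 *: (A *m A *m X) + 2^-1 *: (X *m (B *m B)) + (A *m W0 + W0 *m B + A *m X *m B))
   + (W0 + A *m X + X *m B).
  apply: cvgD; first by apply: cvgZ => //; exact: spin_expansion2.
  by repeat apply: cvgD => //; exact: cvg_cst.
rewrite scale0r add0r; apply: cvg_trans; apply: near_eq_cvg; near=> a.
have t0 : tau a != 0 by near: a.
rewrite /G scalerA expr2 invfM mulrA mulfV// mul1r.
by rewrite scalerBr scalerA mulVf// scale1r subrK.
Unshelve. all: by end_near. Qed.

End CayleyLimits.

(** * Rectangular diagonal matrices and their stabilizers *)

Section RectangularDiagonal.
Context {R : realType}.

Definition rdiag m n (x : 'cV[R]_n) : 'M[R]_(m, n) :=
  \matrix_(i < m, j < n) (if (i : nat) == j then x j 0 else 0).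

Lemma rdiagD m n (x y : 'cV[R]_n) : rdiag m (x + y) = rdiag m x + rdiag m y.
Proof. by apply/matrixP => i j; rewrite !mxE; case: ifP; rewrite ?addr0. Qed.

Lemma rdiagZ m n a (x : 'cV[R]_n) : rdiag m (a *: x) = a *: rdiag m x.
Proof. by apply/matrixP => i j; rewrite !mxE; case: ifP; rewrite ?mulr0. Qed.

Lemma rdiag0 m n : rdiag m (0 : 'cV[R]_n) = 0.
Proof. by apply/matrixP => i j; rewrite !mxE if_same. Qed.

Lemma rdiag_mulC m n (x y : 'cV[R]_n) :
  rdiag m x *m (rdiag m y)^T = rdiag m y *m (rdiag m x)^T.
Proof.
apply/matrixP => i j; rewrite !mxE; apply: eq_bigr => k _; rewrite !mxE.
by do 2!case: ifP => _; rewrite ?mulr0 ?mul0r// mulrC.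
Qed.

Lemma rdiag_mulTC m n (x y : 'cV[R]_n) :
  (rdiag m x)^T *m rdiag m y = (rdiag m y)^T *m rdiag m x.
Proof.
apply/matrixP => i j; rewrite !mxE; apply: eq_bigr => k _; rewrite !mxE.
case: eqP => ki; case: eqP => kj; rewrite ?mulr0 ?mul0r//.
have -> : i = j by apply: val_inj; rewrite /= -ki -kj.
by rewrite mulrC.
Qed.

(** Rotating the left or the right singular frame changes the inner product of
    two simultaneously diagonal matrices only to second order. *)
Lemma mxdot_rdiag_skewl m n (A : 'M[R]_m) (x y : 'cV[R]_n) : skewsym A ->
  mxdot (rdiag m y) (A *m rdiag m x) = 0.
Proof.
move=> As; rewrite mxdotC mxdot_mulr mxdotC mxdot_skew//.
by rewrite trmx_mul trmxK rdiag_mulC.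
Qed.

Lemma mxdot_rdiag_skewr m n (B : 'M[R]_n) (x y : 'cV[R]_n) : skewsym B ->
  mxdot (rdiag m y) (rdiag m x *m B) = 0.
Proof.
move=> Bs; rewrite mxdotC mxdot_mull mxdotC mxdot_skew//.
by rewrite trmx_mul trmxK rdiag_mulTC.
Qed.

Variables (m n : nat) (hnm : (n <= m)%N).
Local Notation w := (widen_ord hnm).

Lemma widen_inj : injective w.
Proof. by move=> i j /(congr1 val) /= ij; apply: val_inj. Qed.

Lemma rdiag_widen (x : 'cV[R]_n) i j : rdiag m x (w i) j = if i == j then x j 0 else 0.
Proof. by rewrite mxE. Qed.

Lemma rdiag_sum_delta (x : 'cV[R]_n) :
  rdiag m x = \sum_a x a 0 *: delta_mx (w a) a.
Proof.
apply/matrixP => i j; rewrite summxE mxE (bigD1 j)//= big1 ?addr0 => [|k kj].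
  by rewrite !mxE eqxx andbT -val_eqE /=; case: eqP => _; rewrite ?mulr1 ?mulr0.
by rewrite !mxE [j == k]eq_sym (negPf kj) andbF mulr0.
Qed.

Lemma mxdot_rdiag (H : 'M[R]_(m, n)) (x : 'cV[R]_n) :
  mxdot H (rdiag m x) = \sum_a x a 0 * H (w a) a.
Proof.
rewrite rdiag_sum_delta.
elim/big_ind2 : _ => [|A a B b <- <-|a _]; first exact: mxdot0r.
  by rewrite mxdotDr.
by rewrite mxdotZr mxdot_delta.
Qed.

Lemma delta_rdiag p (i : 'I_p) b (x : 'cV[R]_n) :
  delta_mx i (w b) *m rdiag m x = x b 0 *: delta_mx i b.
Proof.
apply/matrixP => k l; rewrite !mxE (bigD1 (w b))//= big1 ?addr0 => [|c cb].
  rewrite !mxE eqxx andbT [l == b]eq_sym -!val_eqE /=.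
  case: (nat_of_ord b =P l) => [/val_inj ->|_]; rewrite ?andbT ?andbF ?mulr0 //.
  exact: mulrC.
by rewrite mxE (negPf cb) andbF mul0r.
Qed.

Lemma delta_rdiag0 p (i : 'I_p) (k : 'I_m) (x : 'cV[R]_n) : (n <= k)%N ->
  delta_mx i k *m rdiag m x = 0.
Proof.
move=> nk; apply/matrixP => a l; rewrite !mxE big1// => c _; rewrite !mxE.
case: (nat_of_ord c =P l) => cl; rewrite ?mulr0//.
have -> : (c == k) = false.
  by rewrite -val_eqE /= cl ltn_eqF// (leq_trans (ltn_ord l)).
by rewrite andbF mul0r.
Qed.

Lemma rdiag_delta p a (j : 'I_p) (x : 'cV[R]_n) :
  rdiag m x *m delta_mx a j = x a 0 *: delta_mx (w a) j.
Proof.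
apply/matrixP => k l; rewrite !mxE (bigD1 a)//= big1 ?addr0 => [|c cb].
  rewrite !mxE eqxx -!val_eqE /=.
  by case: (nat_of_ord k =P a) => _; rewrite ?mul0r ?mulr0.
by rewrite [in X in _ * X]mxE (negPf cb) mulr0.
Qed.

(** The infinitesimal rotation in the coordinate plane (i, j). *)
Definition plane p (i j : 'I_p) : 'M[R]_p := delta_mx i j - delta_mx j i.

Lemma plane_skewsym p (i j : 'I_p) : skewsym (plane i j).
Proof. by rewrite /skewsym /plane linearB /= !trmx_delta opprB. Qed.

Lemma plane_rdiag i j (x : 'cV[R]_n) :
  plane (w i) (w j) *m rdiag m x = x j 0 *: delta_mx (w i) j - x i 0 *: delta_mx (w j) i.
Proof. by rewrite /plane mulmxBl !delta_rdiag. Qed.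

Lemma rdiag_plane i j (x : 'cV[R]_n) :
  rdiag m x *m plane i j = x i 0 *: delta_mx (w i) j - x j 0 *: delta_mx (w j) i.
Proof. by rewrite /plane mulmxBr !rdiag_delta. Qed.

End RectangularDiagonal.

Section Stabilizer.
Context {R : realType} {m n : nat}.
Implicit Types (x y c : 'cV[R]_n) (h : 'M[R]_(m, n)) (Q : 'M[R]_m * 'M[R]_n).

(** Any two pairs of SVD frames of a matrix with singular values x differ by an
    element of this stabilizer. *)
Definition stab x : set ('M[R]_m * 'M[R]_n) :=
  [set Q | [/\ orthogonal_mx Q.1, orthogonal_mx Q.2 &
               Q.1 *m rdiag m x = rdiag m x *m Q.2]].

Lemma stab1 x : stab x (1%:M, 1%:M).
Proof. by split=> /=; rewrite ?mul1mx ?mulmx1//; exact: orthogonal_mx1. Qed.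

Lemma stabM x Q Q' : stab x Q -> stab x Q' -> stab x (Q.1 *m Q'.1, Q.2 *m Q'.2).
Proof.
case=> u1 u2 e [p1 p2 e']; split => /=; do 1?exact: orthogonal_mxM.
by rewrite -mulmxA e' !mulmxA e.
Qed.

Lemma stabE x Q : stab x Q -> Q.1 *m rdiag m x *m Q.2^T = rdiag m x.
Proof. by case=> _ u2 ->; rewrite -mulmxA orthogonal_mxC// mulmx1. Qed.

Lemma stabTE x Q : stab x Q -> Q.1^T *m rdiag m x *m Q.2 = rdiag m x.
Proof. by case=> u1 u2 e; rewrite -mulmxA -e mulmxA u1 mul1mx. Qed.

Lemma stab0 Q : orthogonal_mx Q.1 -> orthogonal_mx Q.2 -> stab 0 Q.
Proof. by move=> u1 u2; split; rewrite // rdiag0 mulmx0 mul0mx. Qed.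

Lemma compact_stab2 x y : compact (stab x `&` stab y).
Proof.
have cfst : continuous (fun Q => Q.1) by move=> Q; exact: cvg_fst.
have csnd : continuous (fun Q => Q.2) by move=> Q; exact: cvg_snd.
have cl z : closed [set Q : 'M[R]_m * 'M[R]_n | Q.1 *m rdiag m z = rdiag m z *m Q.2].
  apply: closed_eq_mx; apply: continuous_mulmx => //; exact: cst_continuous.
have cO := compact_setX (@compact_orthogonal R m) (@compact_orthogonal R n).
have -> : stab x `&` stab y =
    ([set Q | orthogonal_mx Q] `*` [set Q | orthogonal_mx Q]) `&`
    ([set Q : 'M[R]_m * 'M[R]_n | Q.1 *m rdiag m x = rdiag m x *m Q.2] `&`
     [set Q : 'M[R]_m * 'M[R]_n | Q.1 *m rdiag m y = rdiag m y *m Q.2]).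
  apply/seteqP; split=> [Q [[u1 u2 e] [_ _ f']]//|Q [[u1 u2] [e f]]].
  by split; split.
apply: compact_closedI => //; exact: closedI.
Qed.

Lemma max_stab2 x y h c : exists2 Q, (stab x `&` stab y) Q &
  forall Q', (stab x `&` stab y) Q' ->
    mxdot (Q'.1^T *m h *m Q'.2) (rdiag m c) <= mxdot (Q.1^T *m h *m Q.2) (rdiag m c).
Proof.
have cfst : continuous (fun Q => Q.1) by move=> Q; exact: cvg_fst.
have csnd : continuous (fun Q => Q.2) by move=> Q; exact: cvg_snd.
have cont : continuous (fun Q => mxdot (Q.1^T *m h *m Q.2) (rdiag m c)).
  apply: continuous_mxdot; last exact: cst_continuous.
  apply: continuous_mulmx => //; apply: continuous_mulmx; last exact: cst_continuous.
  exact: continuous_trmx.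
have ne : stab x `&` stab y !=set0 by exists (1%:M, 1%:M); split; exact: stab1.
have [Q] := compact_EVT_max ne (@compact_stab2 x y) (continuous_subspaceT cont).
by rewrite inE => SQ Qmax; exists Q => // Q' SQ'; apply: Qmax; rewrite inE.
Qed.

Lemma stab_spin x A B t : skewsym A -> skewsym B -> A *m rdiag m x = rdiag m x *m B ->
  stab x (spin A t, spin B t).
Proof.
by move=> As Bs e; split=> /=; [exact: spin_orthogonal..|exact: spin_intertwine].
Qed.

(** Fermat's rule along the curves of rotations with velocities A and B. *)
Lemma first_order_max_le A B h C : skewsym A -> skewsym B ->
  (forall t, mxdot ((spin A t)^T *m h *m spin B t) C <= mxdot h C) ->
  mxdot h (A *m C - C *m B) <= 0.
Proof.
move=> As Bs hmax.
have t0 : (fun t : R => t) @ 0^'+ --> (0 : R) by exact: cvg_at_right_filter.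
have FF : Filter (0 : R)^'+ by exact: at_right_proper_filter.
have lim := cvg_mxdot (spin_expansion1 (X := h) t0 (skewsymN As) Bs
  (cvg_cst (0 : 'M[R]_(m, n))) (nbhs_right_neq _)) (cvg_cst C).
move: lim => /(_ FF FF FF FF) /=; rewrite add0r => lim.
rewrite mxdotBr.
have -> : mxdot h (A *m C) - mxdot h (C *m B) = mxdot (- A *m h + h *m B) C.
  by rewrite mxdotDl mxdot_mull mxdot_mulr linearN /= As Bs opprK mulmxN mxdotNr.
apply: (cvgr_to_le lim); near=> t.
have tp : 0 < t by near: t; exact: nbhs_right_gt.
rewrite scaler0 addr0 spinN// mxdotZl mxdotBl pmulr_rle0 ?invr_gt0// subr_le0.
exact: hmax.
Unshelve. all: by end_near. Qed.

Lemma first_order_max A B h C : skewsym A -> skewsym B ->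
  (forall t, mxdot ((spin A t)^T *m h *m spin B t) C <= mxdot h C) ->
  mxdot h (A *m C - C *m B) = 0.
Proof.
move=> As Bs hmax; apply/eqP; rewrite eq_le first_order_max_le//=.
rewrite -oppr_le0 -mxdotNr opprB addrC -mulNmx -[C *m B]opprK -mulmxN.
apply: first_order_max_le; do 1?exact: skewsymN.
by move=> t; rewrite !spin_oppr; exact: hmax.
Qed.

End Stabilizer.

(** * Frames adapted to a direction *)

Section AdaptedFrame.
Context {R : realType} {m n : nat}.
Variable hnm : (n <= m)%N.
Implicit Types (x y c : 'cV[R]_n) (h : 'M[R]_(m, n)).
Local Notation w := (widen_ord hnm).

(** The shape of a direction in a singular frame of a base point with singular
    values x that makes the first-order motion of the singular values visible on
    the diagonal: over each block of equal positive singular values the symmetric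
    part is diagonal and nonincreasing, and over the zero block the direction is
    diagonal, nonnegative and nonincreasing. *)
Record adapted x h : Prop := Adapted {
  adapted_sym : forall i j : 'I_n, i != j -> x i 0 = x j 0 -> h (w i) j + h (w j) i = 0;
  adapted_le : forall i j : 'I_n, (i <= j)%N -> x i 0 = x j 0 -> h (w j) j <= h (w i) i;
  adapted_zero : forall (i : 'I_m) (j : 'I_n), (i : nat) != j -> x j 0 = 0 ->
    (forall k : 'I_n, i = w k -> x k 0 = 0) -> h i j = 0;
  adapted_ge0 : forall i : 'I_n, x i 0 = 0 -> 0 <= h (w i) i }.

Lemma reflection_orthogonal p (E : 'M[R]_p) :
  E^T = E -> E *m E = 2 *: E -> orthogonal_mx (1%:M - E).
Proof.
move=> Et E2; rewrite /orthogonal_mx [(_ - _)^T]linearB /= trmx1 Et mulmxBr mulmx1 mulmxBl mul1mx E2.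
by apply/matrixP => i j; rewrite !mxE; ring.
Qed.

Definition flip p (i : 'I_p) : 'M[R]_p := 1%:M - 2 *: delta_mx i i.

Lemma flip_orthogonal p (i : 'I_p) : orthogonal_mx (flip i).
Proof.
apply: reflection_orthogonal; first by rewrite linearZ /= trmx_delta.
by rewrite -scalemxAl -scalemxAr mul_delta_mx.
Qed.

Lemma flip_rdiag x i : flip (w i) *m rdiag m x = rdiag m x - (2 * x i 0) *: delta_mx (w i) i.
Proof. by rewrite mulmxBl mul1mx -scalemxAl delta_rdiag scalerA. Qed.

Lemma tperm_orthogonal p (i j : 'I_p) : orthogonal_mx (tperm_mx i j : 'M[R]_p).
Proof. by rewrite /orthogonal_mx tr_perm_mx tpermV -perm_mxM tperm2 perm_mx1. Qed.

Lemma stab_tperm x i j : x i 0 = x j 0 -> stab x (tperm_mx (w i) (w j), tperm_mx i j).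
Proof.
move=> xij; split=> /=; [exact: tperm_orthogonal..|].
rewrite -xrowE -xcolE; apply/matrixP => a b; rewrite !mxE.
have xt : x (tperm i j b) 0 = x b 0 by case: tpermP => [->|->|].
rewrite xt; have ab : (tperm (w i) (w j) a == w b) = (a == w (tperm i j b)).
  rewrite (can2_eq (tpermK _ _) (tpermK _ _)).
  by rewrite (inj_tperm _ _ _ (@widen_inj m n hnm)).
by move: ab; rewrite -!val_eqE /= => ->.
Qed.

Lemma mxdot_tperm h c i j : i != j ->
  mxdot ((tperm_mx (w i) (w j))^T *m h *m tperm_mx i j) (rdiag m c) =
  mxdot h (rdiag m c) + (c i 0 - c j 0) * (h (w j) j - h (w i) i).
Proof.
move=> ij; rewrite tr_perm_mx tpermV -xrowE -xcolE !(mxdot_rdiag hnm).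
have E a : xcol i j (xrow (w i) (w j) h) (w a) a = h (w (tperm i j a)) (tperm i j a).
  by rewrite !mxE (inj_tperm _ _ _ (@widen_inj m n hnm)).
under eq_bigr do rewrite E.
rewrite (bigD1 i)//= (bigD1 j) 1?eq_sym//= tpermL tpermR.
rewrite [in RHS](bigD1 i)//= [in RHS](bigD1 j) 1?eq_sym//=.
rewrite (eq_bigr (fun a => c a 0 * h (w a) a)) => [|a /andP[ai aj]]; first ring.
by rewrite tpermD// eq_sym.
Qed.

(** Moving H by the stabilizer of x to maximize its pairing with diag(y), and then,
    without disturbing y, with a diagonal matrix of distinct positive entries, brings it to
    adapted form: the first-order conditions along plane rotations kill the
    off-diagonal entries, exchanging two indices sorts the diagonal, and a sign
    flip makes it nonnegative on the zero block. *)
Lemma adapted_frame x y h :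
  (forall i, 0 <= y i 0) ->
  (forall i j : 'I_n, (i <= j)%N -> y j 0 <= y i 0) ->
  (forall Q, stab x Q -> mxdot (Q.1^T *m h *m Q.2) (rdiag m y) <= mxdot h (rdiag m y)) ->
  exists Q, [/\ stab x Q, stab y Q & adapted x (Q.1^T *m h *m Q.2)].
Proof.
move=> y0 ys ymax.
(* A vector of distinct positive entries, to break the ties of y. *)
pose N : 'cV[R]_n := \col_i (n - i)%:R.
have N0 i : 0 < N i 0 by rewrite mxE ltr0n subn_gt0.
have Nlt (i j : 'I_n) : (i < j)%N -> N j 0 < N i 0.
  by move=> ij; rewrite !mxE ltr_nat ltn_sub2l.
have [Q [Qx Qy] Qmax] := max_stab2 x y h N.
exists Q; split => //; set h' := _ *m Q.2.
have ymax' Q' : stab x Q' -> mxdot (Q'.1^T *m h' *m Q'.2) (rdiag m y) <= mxdot h' (rdiag m y).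
  move=> Sx; have -> : mxdot h' (rdiag m y) = mxdot h (rdiag m y).
    rewrite /h' -{2}(stabE Qy) mxdot_mulr -!mulmxA mxdot_mull trmxK.
    by rewrite !mulmxA.
  by have := ymax _ (stabM Qx Sx); rewrite /= trmx_mul !mulmxA.
have Nmax' Q' : stab x Q' -> stab y Q' ->
    mxdot (Q'.1^T *m h' *m Q'.2) (rdiag m N) <= mxdot h' (rdiag m N).
  move=> Sx Sy; have := Qmax _ (conj (stabM Qx Sx) (stabM Qy Sy)).
  by rewrite /= trmx_mul !mulmxA.
clearbody h'; clear ymax Qmax Qx Qy Q h.
have sym i j : i != j -> x i 0 = x j 0 -> h' (w i) j + h' (w j) i = 0.
  move=> ij xij.
  have [c cij cmax] : exists2 c : 'cV[R]_n, c i 0 != c j 0 & forall t,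
      mxdot ((spin (plane (w i) (w j)) t)^T *m h' *m spin (plane i j) t) (rdiag m c)
      <= mxdot h' (rdiag m c).
    have Sp (z : 'cV[R]_n) t : z i 0 = z j 0 -> stab z (spin (plane (w i) (w j)) t, spin (plane i j) t).
      move=> zij; apply: stab_spin; [exact: plane_skewsym..|].
      by rewrite plane_rdiag rdiag_plane zij.
    have [yij|yij] := eqVneq (y i 0) (y j 0); last first.
      by exists y => // t; exact: ymax' (Sp x t xij).
    exists N; last by move=> t; exact: Nmax' (Sp x t xij) (Sp y t yij).
    case: (ltngtP i j) => [/Nlt/gt_eqF ->|/Nlt/lt_eqF ->|/val_inj/eqP] //.
    by rewrite (negPf ij).
  have := first_order_max (plane_skewsym _ _) (plane_skewsym _ _) cmax.
  rewrite plane_rdiag rdiag_plane !mxdotBr !mxdotZr !mxdot_delta => /eqP.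
  have -> : c j 0 * h' (w i) j - c i 0 * h' (w j) i -
     (c i 0 * h' (w i) j - c j 0 * h' (w j) i) =
     (c j 0 - c i 0) * (h' (w i) j + h' (w j) i) by ring.
  by rewrite mulf_eq0 subr_eq0 eq_sym (negPf cij) => /eqP.
split => //.
- move=> i j; rewrite leq_eqVlt => /predU1P[/val_inj ->//|lij] xij.
  have ij : i != j by rewrite -val_eqE /= ltn_eqF.
  have [c cij cmax] : exists2 c : 'cV[R]_n, c j 0 < c i 0 &
      mxdot ((tperm_mx (w i) (w j))^T *m h' *m tperm_mx i j) (rdiag m c) <= mxdot h' (rdiag m c).
    have [yij|yij] := eqVneq (y i 0) (y j 0); last first.
      exists y; first by rewrite lt_neqAle eq_sym yij ys // ltnW.
      exact: ymax' (stab_tperm xij).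
    exists N; first exact: Nlt.
    exact: Nmax' (stab_tperm xij) (stab_tperm yij).
  move: cmax; rewrite mxdot_tperm// -lerBrDl subrr pmulr_rle0 ?subr_gt0//.
  by rewrite subr_le0.
- move=> i j ij xj xi.
  have mx0 (A : 'M[R]_m) c : (forall t, mxdot ((spin A t)^T *m h' *m spin 0 t) (rdiag m c)
      <= mxdot h' (rdiag m c)) -> skewsym A -> mxdot h' (A *m rdiag m c) = 0.
    move=> cmax As; have := first_order_max As _ cmax.
    by rewrite mulmx0 subr0; apply; rewrite /skewsym trmx0 oppr0.
  have sk0 : skewsym (0 : 'M[R]_n) by rewrite /skewsym trmx0 oppr0.
  have [ni|] := leqP n i.
    have Sp (z : 'cV[R]_n) t : z j 0 = 0 -> stab z (spin (plane i (w j)) t, spin 0 t).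
      move=> zj; apply: stab_spin; [exact: plane_skewsym|exact: sk0|].
      by rewrite mulmx0 mulmxBl delta_rdiag delta_rdiag0// zj scale0r subr0.
    have [c cj cmax] : exists2 c : 'cV[R]_n, c j 0 != 0 & forall t,
        mxdot ((spin (plane i (w j)) t)^T *m h' *m spin 0 t) (rdiag m c) <= mxdot h' (rdiag m c).
      have [yj|yj] := eqVneq (y j 0) 0.
        exists N; first by rewrite gt_eqF.
        by move=> t; exact: Nmax' (Sp x t xj) (Sp y t yj).
      by exists y => // t; exact: ymax' (Sp x t xj).
    have := mx0 _ _ cmax (plane_skewsym _ _).
    rewrite mulmxBl delta_rdiag delta_rdiag0// subr0 mxdotZr mxdot_delta => /eqP.
    by rewrite mulf_eq0 (negPf cj) => /eqP.
  move=> ltin; pose k := Ordinal ltin.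
  have ik : i = w k by exact: val_inj.
  have xk := xi _ ik; have kj : k != j by rewrite -val_eqE.
  have Sp (z : 'cV[R]_n) t : z k 0 = 0 -> z j 0 = 0 -> stab z (spin (plane (w k) (w j)) t, spin 0 t).
    move=> zk zj; apply: stab_spin; [exact: plane_skewsym|exact: sk0|].
    by rewrite mulmx0 plane_rdiag zk zj !scale0r subr0.
  have [c [ck cj ckj] cmax] : exists2 c : 'cV[R]_n, [/\ 0 <= c k 0, 0 <= c j 0
      & c k 0 + c j 0 != 0] & forall t,
      mxdot ((spin (plane (w k) (w j)) t)^T *m h' *m spin 0 t) (rdiag m c)
      <= mxdot h' (rdiag m c).
    have [|ykj] := eqVneq (y k 0 + y j 0) 0.
      move/eqP; rewrite paddr_eq0// => /andP[/eqP yk /eqP yj].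
      exists N; first by split; rewrite ?ltW// gt_eqF// addr_gt0.
      by move=> t; exact: Nmax' (Sp x t xk xj) (Sp y t yk yj).
    by exists y => // t; exact: ymax' (Sp x t xk xj).
  have := mx0 _ _ cmax (plane_skewsym _ _).
  rewrite plane_rdiag mxdotBr !mxdotZr !mxdot_delta ik.
  have /eqP := sym _ _ kj (etrans xk (esym xj)); rewrite addr_eq0 => /eqP ->.
  rewrite mulrN -opprD -mulrDl => /eqP; rewrite oppr_eq0 mulf_eq0 addrC (negPf ckj) /=.
  by move=> /eqP ->; rewrite oppr0.
- move=> i xi.
  have S1 (z : 'cV[R]_n) : z i 0 = 0 -> stab z (flip (w i), 1%:M).
    move=> zi; split=> /=; [exact: flip_orthogonal|exact: orthogonal_mx1|].
    by rewrite flip_rdiag zi mulr0 scale0r subr0 mulmx1.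
  have [c ci cmax] : exists2 c : 'cV[R]_n, 0 < c i 0 &
      mxdot ((flip (w i))^T *m h' *m 1%:M) (rdiag m c) <= mxdot h' (rdiag m c).
    have [yi|yi] := eqVneq (y i 0) 0.
      by exists N => //; exact: Nmax' (S1 _ xi) (S1 _ yi).
    by exists y; [rewrite lt_neqAle eq_sym yi y0|exact: ymax' (S1 _ xi)].
  move: cmax; rewrite mulmx1 mxdot_mull trmxK flip_rdiag mxdotBr mxdotZr mxdot_delta.
  by rewrite lerBlDr lerDl pmulr_rge0// mulr_gt0.
Qed.

End AdaptedFrame.

(** * Singular values *)

Section SingularValues.
Context {R : realType} {m n : nat}.
Variable hnm : (n <= m)%N.
Implicit Types (x y z : 'cV[R]_n) (X : 'M[R]_(m, n)).
Local Notation w := (widen_ord hnm).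

Definition sorted_nneg x : Prop :=
  (forall i, 0 <= x i 0) /\ (forall i j : 'I_n, (i <= j)%N -> x j 0 <= x i 0).

Lemma sigma_sorted X : sorted_nneg (sigma X).
Proof. by have [s0 ss _] := sigmaP X; split. Qed.

Lemma mxdot_colE x y : mxdot x y = \sum_i x i 0 * y i 0.
Proof. by rewrite mxdotE; apply: eq_bigr => i _; rewrite big_ord1. Qed.

Lemma mxdot_rdiag_col x (H : 'M[R]_(m, n)) :
  mxdot H (rdiag m x) = mxdot (\col_i H (w i) i) x.
Proof.
by rewrite (mxdot_rdiag hnm) mxdot_colE; apply: eq_bigr => i _; rewrite mxE mulrC.
Qed.

Lemma mxdot_rdiag2 x y : mxdot (rdiag m x) (rdiag m y) = mxdot x y.
Proof.
rewrite mxdot_rdiag_col; congr mxdot.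
by apply/colP => i; rewrite mxE rdiag_widen eqxx.
Qed.

Lemma adapted0 h : adapted hnm (0 : 'cV[R]_n) h ->
  h = rdiag m (\col_i h (w i) i) /\ sorted_nneg (\col_i h (w i) i).
Proof.
move=> ah; split.
  apply/matrixP => i j; rewrite !mxE; case: (nat_of_ord i =P j) => [ij|/eqP ij].
    by congr (h _ j); exact: val_inj.
  by apply: (adapted_zero ah) => [//||k _]; rewrite mxE.
split=> [i|i j ij]; rewrite !mxE; first by apply: (adapted_ge0 ah); rewrite mxE.
by apply: (adapted_le ah) => //; rewrite !mxE.
Qed.

Lemma char_poly_rdiag (Q1 : 'M[R]_m) (Q2 : 'M[R]_n) z X :
  orthogonal_mx Q1 -> orthogonal_mx Q2 -> X = Q1 *m rdiag m z *m Q2^T ->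
  char_poly (X^T *m X) = \prod_(i < n) ('X - (z i 0 ^+ 2)%:P).
Proof.
move=> u1 u2 ->.
have [Q2u Q2i] : Q2^T \in unitmx /\ invmx Q2^T = Q2.
  have Qu : Q2^T \in unitmx by case/mulmx1_unit: u2.
  by split=> //; apply: (can_inj (mulmxK Qu)); rewrite mulVmx// orthogonal_mxC.
have -> : (Q1 *m rdiag m z *m Q2^T)^T *m (Q1 *m rdiag m z *m Q2^T) =
    invmx Q2^T *m ((rdiag m z)^T *m rdiag m z) *m Q2^T.
  rewrite Q2i !trmx_mul trmxK !mulmxA -[_ *m Q1^T *m Q1]mulmxA u1 mulmx1 //.
rewrite char_poly_simil//.
have -> : (rdiag m z)^T *m rdiag m z = diag_mx (\row_i (z i 0 ^+ 2)).
  apply/matrixP => i j; rewrite !mxE (bigD1 (w i))//= big1 ?addr0 => [|k kj].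
    rewrite !mxE /= eqxx -val_eqE /=; case: eqP => [/val_inj ->|_].
      by rewrite expr2 mulr1n.
    by rewrite mulr0 mulr0n.
  rewrite !mxE; case: (nat_of_ord k =P i) => [ki|]; last by rewrite mul0r.
  by case/eqP: kj; exact: val_inj.
rewrite char_poly_trig ?diag_mx_is_trig//.
by apply: eq_bigr => i _; rewrite !mxE eqxx mulr1n.
Qed.

Lemma sigma_rdiag_sorted (Q1 : 'M[R]_m) (Q2 : 'M[R]_n) z :
  orthogonal_mx Q1 -> orthogonal_mx Q2 -> sorted_nneg z ->
  sigma (Q1 *m rdiag m z *m Q2^T) = z.
Proof.
move=> u1 u2 [z0 zs]; apply: (is_singular_values_uniq (sigmaP _)).
by split => //; exact: (char_poly_rdiag u1 u2 erefl).
Qed.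

(** For x = 0 every pair of orthogonal matrices is in the stabilizer, and adapted
    form is diagonal form. *)
Lemma svd_exists X : exists Q1 Q2,
  [/\ orthogonal_mx Q1, orthogonal_mx Q2 & X = Q1 *m rdiag m (sigma X) *m Q2^T].
Proof.
have [|||[Q1 Q2] [[/= u1 u2 _] _ /adapted0 [+ srt]]] := @adapted_frame R m n hnm 0 0 X.
- by move=> i; rewrite mxE.
- by move=> i j _; rewrite !mxE.
- by move=> Q _; rewrite rdiag0 !mxdot0r.
set d := \col_i _ in srt *; move=> Xd; exists Q1, Q2; split => //.
have XE : X = Q1 *m rdiag m d *m Q2^T.
  by rewrite -Xd !mulmxA orthogonal_mxC// mul1mx -mulmxA orthogonal_mxC// mulmx1.
by rewrite [in sigma X]XE sigma_rdiag_sorted.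
Qed.

(** Von Neumann's trace inequality. A maximizer of the left-hand side over all
    orthogonal frames is adapted, hence is itself a singular value decomposition
    of X. *)
Lemma von_neumann X y (Q1 : 'M[R]_m) (Q2 : 'M[R]_n) :
  orthogonal_mx Q1 -> orthogonal_mx Q2 -> sorted_nneg y ->
  mxdot X (Q1 *m rdiag m y *m Q2^T) <= mxdot (sigma X) y.
Proof.
move=> u1 u2 [y0 ys].
have [[P1 P2] [[/= p1 p2 _] _] Pmax] := max_stab2 (0 : 'cV[R]_n) 0 X y.
set X' := P1^T *m X *m P2 in Pmax.
have [|||[S1 S2] [[/= s1 s2 _] Sy /adapted0 [+ srt]]] := @adapted_frame R m n hnm 0 y X' => //.
  move=> Q S; have S0 := stabM (stab0 (Q := (P1, P2)) p1 p2) S.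
  by have := Pmax _ (conj S0 S0); rewrite /= trmx_mul /X' !mulmxA.
set d := \col_i _ in srt *; move=> Xd.
have XE : X = (P1 *m S1) *m rdiag m d *m (P2 *m S2)^T.
  rewrite -Xd trmx_mul -!mulmxA [S2 *m _]mulmxA orthogonal_mxC// mul1mx.
  rewrite [S1 *m _]mulmxA orthogonal_mxC// mul1mx (orthogonal_mxC p2) mulmx1.
  by rewrite mulmxA orthogonal_mxC// mul1mx.
have -> : sigma X = d by rewrite XE sigma_rdiag_sorted//; exact: orthogonal_mxM.
have S0 := stab0 (Q := (Q1, Q2)) u1 u2.
have -> : mxdot X (Q1 *m rdiag m y *m Q2^T) = mxdot (Q1^T *m X *m Q2) (rdiag m y).
  by rewrite mxdot_mulr mxdot_mull trmxK mulmxA.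
apply: le_trans (Pmax _ (conj S0 S0)) _ => /=.
rewrite -/X' -mxdot_rdiag2 -Xd.
rewrite -[in X in _ <= X](stabTE Sy) /= -(trmxK S2).
by rewrite mxdot_orth ?trmxK//; exact: orthogonal_mxT.
Qed.

(** X and sigma X have the same norm, so that only the cross terms of the squared
    distances differ, and they compare by von Neumann's inequality. *)
Lemma sigma_lipschitz X Z : frobenius (sigma X - sigma Z) <= frobenius (X - Z).
Proof.
have nrm (W : 'M[R]_(m, n)) : mxdot (sigma W) (sigma W) = mxdot W W.
  have [Q1 [Q2 [u1 u2 WE]]] := svd_exists W.
  by rewrite {3 4}WE mxdot_orth// mxdot_rdiag2.
rewrite /frobenius ler_sqrt ?mxdot_ge0//.
have sq p q (A B : 'M[R]_(p, q)) :
    mxdot (A - B) (A - B) = mxdot A A + mxdot B B - 2 * mxdot A B.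
  by rewrite mxdotBl !mxdotBr (mxdotC B A); ring.
rewrite !sq !nrm lerD2l lerN2 ler_pM2l//.
have [Q1 [Q2 [u1 u2 ZE]]] := svd_exists Z.
by rewrite {1}ZE; apply: von_neumann => //; exact: sigma_sorted.
Qed.

(** The singular values of a diagonal matrix are its diagonal up to order and
    signs; this is where the absolute symmetry of f enters. *)
Lemma sigma_rdiag_signed (Q1 : 'M[R]_m) (Q2 : 'M[R]_n) z :
  orthogonal_mx Q1 -> orthogonal_mx Q2 ->
  exists2 P, signed_perm_mx P & sigma (Q1 *m rdiag m z *m Q2^T) = P *m z.
Proof.
move=> u1 u2; set X := _ *m Q2^T.
have [s0 _ cp] := sigmaP X.
rewrite (char_poly_rdiag u1 u2 erefl) in cp.
pose t (u : 'cV[R]_n) := [tuple u i 0 ^+ 2 | i < n].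
have /tuple_permP[s es] : perm_eq (t (sigma X)) (t z).
  have T u : \prod_(a <- t u) ('X - a%:P) = \prod_(i < n) ('X - (u i 0 ^+ 2)%:P).
    by rewrite big_tuple; apply: eq_bigr => i _; rewrite tnth_mktuple.
  by apply: prod_XsubC_eq; rewrite !T cp.
have sE i : sigma X i 0 ^+ 2 = z (s i) 0 ^+ 2.
  by have /(congr1 (fun u => tnth u i)) := val_inj es; rewrite !tnth_mktuple.
pose e i := (z (s i) 0 < 0).
exists (diag_mx (\row_i (-1) ^+ e i) *m perm_mx s); first by exists s, e.
apply/colP => i; rewrite -mulmxA -row_permE mul_diag_mx !mxE /e.
have /eqP := sE i; rewrite -[z _ _ ^+ 2]real_normK ?num_real// eqrXn2//.
by move=> /eqP ->; exact: normrEsign.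
Qed.

Lemma abs_sym_rdiag (f : 'cV[R]_n -> \bar R) (Q1 : 'M[R]_m) (Q2 : 'M[R]_n) z :
  absolutely_symmetric f -> orthogonal_mx Q1 -> orthogonal_mx Q2 ->
  f (sigma (Q1 *m rdiag m z *m Q2^T)) = f z.
Proof. by move=> fs u1 u2; have [P sP ->] := sigma_rdiag_signed z u1 u2; exact: fs. Qed.

End SingularValues.

Section AdaptedDecomposition.
Context {R : realType} {m n : nat}.
Variable hnm : (n <= m)%N.
Local Notation w := (widen_ord hnm).

Lemma mulmx_rdiag (A : 'M[R]_m) (x : 'cV[R]_n) i j :
  (A *m rdiag m x) i j = A i (w j) * x j 0.
Proof.
rewrite mxE (bigD1 (w j))//= big1 ?addr0 => [|k kj]; first by rewrite rdiag_widen eqxx.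
rewrite mxE; case: eqP => [e|]; last by rewrite mulr0.
by case/eqP: kj; exact: val_inj.
Qed.

Lemma rdiag_mulmx (B : 'M[R]_n) (x : 'cV[R]_n) i j :
  (rdiag m x *m B) (w i) j = x i 0 * B i j.
Proof.
rewrite mxE (bigD1 i)//= big1 ?addr0 => [|k ki]; first by rewrite rdiag_widen eqxx.
by rewrite rdiag_widen eq_sym (negPf ki) mul0r.
Qed.

Lemma rdiag_mulmx0 (B : 'M[R]_n) (x : 'cV[R]_n) (i : 'I_m) j : (n <= i)%N ->
  (rdiag m x *m B) i j = 0.
Proof.
move=> ni; rewrite mxE big1// => k _; rewrite mxE.
by rewrite gtn_eqF ?mul0r// (leq_trans (ltn_ord k)).
Qed.

(** The extension by zero lets the rows of index at least n be treated as part of the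
    zero block. *)
Definition pad (u : 'I_n -> R) (i : 'I_m) : R := oapp u 0 (insub (val i)).

Lemma pad_widen u i : pad u (w i) = u i.
Proof. by rewrite /pad /= valK. Qed.

Lemma pad_ge u (i : 'I_m) : (n <= i)%N -> pad u i = 0.
Proof. by move=> ni; rewrite /pad insubF// ltnNge ni. Qed.

Lemma widenP (i : 'I_m) : (exists k, i = w k) \/ (n <= i)%N.
Proof.
case: (leqP n i) => [|lt]; first by right.
by left; exists (Ordinal lt); exact: val_inj.
Qed.

(** A direction in adapted form differs from a diagonal one by an infinitesimal
    change of frame: each pair of indices gives a 2 x 2 linear system for the
    entries of A and B, solved by the sum and the difference of its equations.
    The convention a / 0 = 0 covers the blocks of equal singular values. *)
Lemma adapted_decomposition (x : 'cV[R]_n) (h : 'M[R]_(m, n)) :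
  (forall i, 0 <= x i 0) -> adapted hnm x h ->
  exists A B, [/\ skewsym A, skewsym B &
    h = rdiag m (\col_i h (w i) i) + A *m rdiag m x + rdiag m x *m B].
Proof.
move=> x0 ah.
pose px := pad (fun i => x i 0); pose ph (i j : 'I_m) := pad (h i) j.
pose s i j := (ph i j + ph j i) / (px j - px i).
pose e i j := (ph i j - ph j i) / (px i + px j).
have sC i j : s j i = - s i j by rewrite /s addrC -opprB invrN mulrN.
have eC i j : e j i = - e i j by rewrite /e -opprB mulNr [px j + _]addrC.
exists (\matrix_(i, j) (2^-1 * (s i j + e i j))).
exists (\matrix_(i, j) (2^-1 * (e (w i) (w j) - s (w i) (w j)))).
split.
- by apply/matrixP => i j; rewrite !mxE sC eC; ring.
- by apply/matrixP => i j; rewrite !mxE sC eC; ring.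
have px0 i : 0 <= px i.
  by case: (widenP i) => [[k ->]|/pad_ge]; rewrite /px ?pad_widen// => ->.
apply/matrixP => i j; rewrite 2!mxE mulmx_rdiag.
rewrite [rdiag _ _ _ _]mxE [(\matrix_(_, _) _) i (w j)]mxE.
set B := (X in rdiag m x *m X).
have -> : (rdiag m x *m B) i j = px i * (2^-1 * (e i (w j) - s i (w j))).
  case: (widenP i) => [[k ->]|ni]; first by rewrite rdiag_mulmx mxE /px pad_widen.
  by rewrite rdiag_mulmx0// /px pad_ge// mul0r.
have xj : x j 0 = px (w j) by rewrite /px pad_widen.
have hj k : ph k (w j) = h k j by rewrite /ph pad_widen.
case: (nat_of_ord i =P j) => [ij|/eqP ij].
  have -> : i = w j by exact: val_inj.
  rewrite [in RHS]mxE; suff [-> ->] : s (w j) (w j) = 0 /\ e (w j) (w j) = 0 by ring.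
  by rewrite /s /e !subrr invr0 mulr0 mul0r.
rewrite add0r xj.
transitivity (2^-1 * (s i (w j) * (px (w j) - px i) + e i (w j) * (px i + px (w j)))); last first.
  by ring.
have hz : px i = 0 -> px (w j) = 0 -> h i j = 0 /\ ph (w j) i = 0.
  rewrite /px pad_widen => xi xj0.
  have hi0 k : i = w k -> x k 0 = 0 by move=> ik; move: xi; rewrite ik pad_widen.
  split; first exact: (adapted_zero ah).
  case: (widenP i) => [[k ik]|ni]; last by rewrite /ph pad_ge.
  rewrite ik /ph pad_widen; apply: (adapted_zero ah).
  - by rewrite /= eq_sym; move: ij; rewrite ik.
  - exact: hi0.
  - by move=> l /widen_inj <-.
have -> : s i (w j) * (px (w j) - px i) = ph i (w j) + ph (w j) i.
  have [pe|pn] := eqVneq (px (w j) - px i) 0; last by rewrite divfK.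
  rewrite pe mulr0 hj.
  move/eqP: pe; rewrite subr_eq0 => /eqP pe.
  case: (widenP i) => [[k ik]|ni].
    rewrite ik /ph pad_widen (adapted_sym ah)//.
      by move: ij; rewrite ik.
    by move: pe; rewrite ik /px !pad_widen.
  have pi0 : px i = 0 by rewrite /px pad_ge.
  by have [-> ->] := hz pi0 (etrans pe pi0); rewrite addr0.
have -> : e i (w j) * (px i + px (w j)) = ph i (w j) - ph (w j) i.
  have [|pn] := eqVneq (px i + px (w j)) 0; last by rewrite divfK.
  move/eqP; rewrite paddr_eq0// => /andP[/eqP p1 /eqP p2].
  by rewrite p1 p2 addr0 mulr0 hj; have [-> ->] := hz p1 p2; rewrite subr0.
by rewrite hj; field.
Qed.

End AdaptedDecomposition.

(** * Second subderivative of f o sigma in given frames *)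

Lemma exists_EFin_between (R : realType) (a b : \bar R) : (a < b)%E ->
  exists2 c : R, (a < c%:E)%E & (c%:E < b)%E.
Proof.
case: a b => [a||] [b||] //= ab.
- exists ((a + b) / 2); rewrite lte_fin; rewrite lte_fin in ab; lra.
- by exists (a + 1); rewrite ?ltry// lte_fin ltrDl.
- by exists (b - 1); rewrite ?ltNyr// lte_fin ltrBlDr ltrDl.
- by exists 0; rewrite ?ltNyr ?ltry.
Qed.

Section LowerLimits.
Context {R : realType} {T : choiceType} {X : filteredType T}.
Context {F : set_system X} {FF : Filter F}.
Implicit Types (f : X -> \bar R) (l : \bar R) (c : R).

Lemma le_limf_einf f l :
  (forall c, (c%:E < l)%E -> \forall a \near F, (c%:E <= f a)%E) ->
  (l <= limf_einf f F)%E.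
Proof.
move=> fl; rewrite limf_einfE.
have below c : (c%:E < l)%E -> (c%:E <= ereal_sup [set ereal_inf (f @` A) | A in F])%E.
  move=> cl; apply: (@le_trans _ _ (ereal_inf (f @` [set a | (c%:E <= f a)%E]))).
    by apply: le_ereal_inf_tmp => _ [a /= ca <-].
  by apply: ereal_sup_ubound; exists [set a | (c%:E <= f a)%E] => //; exact: fl.
move: below {fl}; case: l => [r||] below; last by rewrite leNye.
- apply/lee_addgt0Pr => e e0; rewrite -leeBlDr// -EFinB; apply: below.
  by rewrite lte_fin ltrBlDr ltrDl.
- rewrite leye_eq; apply/eqP/eqyP => c c0.
  by apply: below; exact: ltry.
Qed.

Lemma lt_limf_einf f l : (l < limf_einf f F)%E -> \forall a \near F, (l < f a)%E.
Proof.
rewrite limf_einfE => /ereal_sup_gt[_ [A FA <-] lA].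
by apply: filterS FA => a Aa; apply: (lt_le_trans lA); apply: ereal_inf_lbound; exists a.
Qed.

Lemma limf_einf_le f l :
  (forall c, (l < c%:E)%E -> forall A, F A -> exists2 a, A a & (f a <= c%:E)%E) ->
  (limf_einf f F <= l)%E.
Proof.
move=> fl; rewrite leNgt; apply/negP => llim.
have [c lc clim] := exists_EFin_between llim.
have [a /= ca] := fl _ lc _ (lt_limf_einf clim).
by rewrite leNgt ca.
Qed.

Lemma limf_einf_lt f l A : (limf_einf f F < l)%E -> F A -> exists2 a, A a & (f a < l)%E.
Proof.
move=> fl FA; apply: contrapT => nA; move: fl; apply/negP; rewrite -leNgt.
apply: le_limf_einf => c cl; apply: filterS FA => a Aa.
rewrite (le_trans (ltW cl))// leNgt; apply/negP => fa; apply: nA; by exists a.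
Qed.

End LowerLimits.

Section SubderivativeBasics.
Context {R : realType} {p q : nat}.
Local Notation E := 'M[R]_(p, q).
Implicit Types (g : E -> \bar R) (x v w : E).

(** The filter along which the difference quotients in direction w are taken. *)
Definition dirs w : set_system (R * E) := filter_prod 0^'+ (nbhs w).

Global Instance dirs_proper w : ProperFilter (dirs w).
Proof. exact: filter_prod_proper. Qed.

Lemma dirs_fst w : (fun tw : R * E => tw.1) @ dirs w --> (0 : R).
Proof.
move=> A /= A0.
have : ((0:R)^'+ A) by apply: cvg_at_right_filter A0; exact: cvg_id.
by move=> A0'; exists (A, setT); [split => //=; exact: filterT|move=> [t v] []].
Qed.

Lemma dirs_snd w : (fun tw : R * E => tw.2) @ dirs w --> w.
Proof. exact: cvg_snd. Qed.

Lemma near_dirs_fst w (P : R -> Prop) :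
  (\forall t \near 0^'+, P t) -> \forall tw \near dirs w, P tw.1.
Proof.
by move=> P0; exists (P, setT); [split => //=; exact: filterT|move=> [t v] []].
Qed.

Lemma dirs_gt0 w : \forall tw \near dirs w, 0 < tw.1.
Proof. by apply: (@near_dirs_fst w (fun t => 0 < t)); exact: nbhs_right_gt. Qed.

Lemma dirs_neq0 w : \forall tw \near dirs w, tw.1 != 0.
Proof. by apply: filterS (dirs_gt0 w) => tw; rewrite lt0r => /andP[]. Qed.

Lemma cvg_dirs (T : Type) (F : set_system T) (FF : Filter F) w
    (t : T -> R) (v : T -> E) :
  t @ F --> (0 : R) -> (\forall a \near F, 0 < t a) -> v @ F --> w ->
  (fun a => (t a, v a)) @ F --> dirs w.
Proof.
move=> t0 tp vw A [[P Q] /= [P0 Qw] PQA].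
apply: filterS3 tp (t0 _ P0) (vw _ Qw) => a ta0 Pa Qa.
by apply: PQA; split => //=; exact: Pa.
Qed.

Lemma dirs_line w : (fun t : R => (t, w)) @ 0^'+ --> dirs w.
Proof.
apply: cvg_dirs; [exact: cvg_at_right_filter|exact: nbhs_right_gt|exact: cvg_cst].
Qed.

Lemma subgradient_le_subderivative g x v w :
  subdifferential g x v -> ((mxdot v w)%:E <= subderivative g x w)%E.
Proof.
move=> [gx gv]; apply: le_limf_einf => c; rewrite lte_fin => cw.
have vw : (fun tw : R * E => mxdot v tw.2) @ dirs w --> mxdot v w.
  by apply: cvg_mxdot; [exact: cvg_cst|exact: dirs_snd].
near=> tw.
have t0 : 0 < tw.1 by near: tw; exact: dirs_gt0.
have ct : c < mxdot v tw.2 by near: tw; exact: cvgr_gt vw _ cw.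
have := gv (x + tw.1 *: tw.2); rewrite addrAC subrr add0r mxdotZr.
case: (g x) gx => // a _; case: (g _) => [b||] //= => [|_]; last first.
  by rewrite mulr_infty gtr0_sg ?invr_gt0// mul1e leey.
rewrite -EFinD lee_fin -EFinB -EFinM lee_fin ler_pdivlMr// => ab.
by have := ler_wpM2r (ltW t0) (ltW ct); lra.
Unshelve. all: by end_near. Qed.

End SubderivativeBasics.

Section QuotientComparison.
Context {R : realType}.
Implicit Types (v : \bar R) (a p s c e : R).

(** Replacing the linear term p of a second-order quotient by p' costs e when
    p and p' differ by e times the denominator s. *)
Lemma le_quotient_shift v a p (p' : R) s c e : 0 < s -> e * s <= p - p' ->
  (c%:E <= (v - a%:E - p%:E) * (s^-1)%:E)%E ->
  ((c + e)%:E <= (v - a%:E - p'%:E) * (s^-1)%:E)%E.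
Proof.
move=> s0 ep; case: v => [v||] /=.
- rewrite -!EFinB -!EFinM !lee_fin !ler_pdivlMr// => cv; lra.
- by move=> _; rewrite mulyr gtr0_sg ?invr_gt0// mul1e leey.
- by rewrite mulNyr gtr0_sg ?invr_gt0// mul1e.
Qed.

Lemma ge_quotient_shift v a p (p' : R) s c e : 0 < s -> p - p' <= e * s ->
  ((v - a%:E - p%:E) * (s^-1)%:E <= c%:E)%E ->
  ((v - a%:E - p'%:E) * (s^-1)%:E <= (c + e)%:E)%E.
Proof.
move=> s0 ep; case: v => [v||] /=.
- rewrite -!EFinB -!EFinM !lee_fin !ler_pdivrMr// => cv; lra.
- by rewrite mulyr gtr0_sg ?invr_gt0// mul1e.
- by move=> _; rewrite mulNyr gtr0_sg ?invr_gt0// mul1e leNye.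
Qed.

End QuotientComparison.

Lemma slope_subE (R : realType) p q (a b w : 'M[R]_(p, q)) (t : R) : t != 0 ->
  t^-1 *: (a + t *: w - b) = w - t^-1 *: (b - a).
Proof. by move=> t0; apply/matrixP => i j; rewrite !mxE; field. Qed.

Section SecondOrderChainRule.
Context {R : realType} {m n : nat}.
Variable hnm : (n <= m)%N.
Variables (f : 'cV[R]_n -> \bar R) (x y d : 'cV[R]_n).
Variables (U : 'M[R]_m) (V : 'M[R]_n) (A : 'M[R]_m) (B : 'M[R]_n).
Hypotheses (fsym : absolutely_symmetric f) (fx : f x \is a fin_num).
Hypotheses (xs : sorted_nneg x) (ys : sorted_nneg y).
Hypothesis xds : \forall t \near 0^'+, sorted_nneg (x + t *: d).
Hypotheses (Uo : orthogonal_mx U) (Vo : orthogonal_mx V).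
Hypotheses (As : skewsym A) (Bs : skewsym B).

Let Dx := rdiag m x.
Let Dy := rdiag m y.
Let Dd := rdiag m d.
Let X0 := U *m Dx *m V^T.
Let Y := U *m Dy *m V^T.
Let H := U *m (Dd + A *m Dx + Dx *m B) *m V^T.

(** The curvature contributed by the rotation of the singular frames along H. *)
Definition frame_curvature : R :=
  - mxdot Dy (A *m A *m Dx + Dx *m (B *m B) + 2 *: (A *m Dx *m B)).

Let curve (t : R) (e : 'cV[R]_n) : 'M[R]_(m, n) :=
  U *m (spin A t *m (Dx + t *: rdiag m e) *m spin B t) *m V^T.

Let curveE t e : curve t e = (U *m spin A t) *m rdiag m (x + t *: e) *m (V *m (spin B t)^T)^T.
Proof. by rewrite rdiagD rdiagZ trmx_mul trmxK /curve !mulmxA. Qed.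

Let Ut t : orthogonal_mx (U *m spin A t).
Proof. by apply: orthogonal_mxM => //; exact: spin_orthogonal. Qed.

Let Vt t : orthogonal_mx (V *m (spin B t)^T).
Proof. by apply: orthogonal_mxM => //; apply: orthogonal_mxT; exact: spin_orthogonal. Qed.

Let sigmaX0 : sigma X0 = x. Proof. by apply: sigma_rdiag_sorted. Qed.
Let rdiag_cvg : (fun te : R * 'cV[R]_n => rdiag m te.2) @ dirs d --> Dd.
Proof.
apply: cvg_mx_entries => i j; rewrite mxE.
have -> : (fun te : R * 'cV[R]_n => rdiag m te.2 i j) =
   (fun te => if (i : nat) == j then te.2 j 0 else 0).
  by apply/funext => te; rewrite mxE.
case: ifP => _; last exact: cvg_cst.
by apply: cvg_entry; exact: dirs_snd.
Qed.

Lemma curve_cvg : (fun te => te.1^-1 *: (curve te.1 te.2 - X0)) @ dirs d --> H.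
Proof.
have cd := rdiag_cvg.
pose K (te : R * 'cV[R]_n) := te.1^-1 *:
  (spin A te.1 *m (Dx + te.1 *: rdiag m te.2) *m spin B te.1 - Dx).
have KL : K @ dirs d --> Dd + A *m Dx + Dx *m B.
  exact: (spin_expansion1 (dirs_fst d) As Bs cd (dirs_neq0 d)).
have -> : (fun te => te.1^-1 *: (curve te.1 te.2 - X0)) = (fun te => U *m K te *m V^T).
  apply/funext => te; rewrite /curve /X0 /K -mulmxBl -mulmxBr.
  by rewrite -scalemxAr -scalemxAl.
by apply: cvg_mulmx; [apply: cvg_mulmx => //|]; exact: cvg_cst.
Qed.

Lemma curve_fst_cvg : (fun tw : R * 'M[R]_(m, n) => tw.1^-1 *: (curve tw.1 d - X0)) @ dirs H --> H.
Proof.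
have c : (fun tw : R * 'M[R]_(m, n) => (tw.1, d)) @ dirs H --> dirs d.
  by apply: cvg_dirs; [exact: dirs_fst|exact: dirs_gt0|exact: cvg_cst].
exact: (cvg_comp (fun tw : R * 'M[R]_(m, n) => (tw.1, d))
  (fun te => te.1^-1 *: (curve te.1 te.2 - X0)) c curve_cvg).
Qed.

(** The singular values of X0 + t w follow those of the rotating curve up to o(t),
    since they are 1-Lipschitz functions of the matrix. *)
Lemma sigma_hadamard :
  (fun tw => tw.1^-1 *: (sigma (X0 + tw.1 *: tw.2) - x)) @ dirs H --> d.
Proof.
have c0 : (fun tw : R * 'M[R]_(m, n) => frobenius (tw.2 - tw.1^-1 *: (curve tw.1 d - X0)))
    @ dirs H --> (0 : R).
  have <- : frobenius (H - H) = 0 by rewrite subrr /frobenius mxdot0r sqrtr0.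
  have cc : (fun tw : R * 'M[R]_(m, n) => tw.2 - tw.1^-1 *: (curve tw.1 d - X0)) @ dirs H
     --> H - H by apply: cvgB; [exact: dirs_snd|exact: curve_fst_cvg].
  exact: (cvg_comp _ _ (cvg_mxdot cc cc) (@sqrt_continuous R _)).
apply/cvgrPdistC_lt => e e0; near=> tw.
have t0 : 0 < tw.1 by near: tw; exact: dirs_gt0.
have st : sorted_nneg (x + tw.1 *: d).
  by near: tw; exact: (near_dirs_fst H xds).
apply: le_lt_trans (mx_norm_le_frobenius _) _.
have -> : tw.1^-1 *: (sigma (X0 + tw.1 *: tw.2) - x) - d =
    tw.1^-1 *: (sigma (X0 + tw.1 *: tw.2) - sigma (curve tw.1 d)).
  rewrite curveE sigma_rdiag_sorted// -[d in LHS]scale1r -(mulVf (lt0r_neq0 t0)).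
  by rewrite -scalerA -scalerBr opprD addrA.
rewrite frobeniusZ; apply: le_lt_trans (ler_wpM2l (normr_ge0 _) (sigma_lipschitz hnm _ _)) _.
rewrite -frobeniusZ.
have -> : tw.1^-1 *: (X0 + tw.1 *: tw.2 - curve tw.1 d) = tw.2 - tw.1^-1 *: (curve tw.1 d - X0).
  exact/slope_subE/lt0r_neq0.
near: tw; exact: cvgr_lt c0 _ e0.
Unshelve. all: by end_near. Qed.

Lemma dsigma_frame : dsigma X0 H = d.
Proof.
rewrite /dsigma sigmaX0; apply: cvg_lim => //.
refine (cvg_comp (fun t => (t, H))
  (fun tw => tw.1^-1 *: (sigma (X0 + tw.1 *: tw.2) - x))
  (@dirs_line _ _ _ H) sigma_hadamard).
Qed.

Let curv2 : 2 * mxdot Dy (2^-1 *: (A *m A *m Dx) + 2^-1 *: (Dx *m (B *m B))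
   + (A *m Dd + Dd *m B + A *m Dx *m B)) = - frame_curvature.
Proof.
rewrite /frame_curvature /Dy /Dx /Dd opprK !mxdotDr !mxdotZr.
rewrite (mxdot_rdiag_skewl d y As) (mxdot_rdiag_skewr m d y Bs).
by field.
Qed.

Let curv2N : 2 * mxdot Dy (2^-1 *: (- A *m - A *m Dx) + 2^-1 *: (Dx *m (- B *m - B))
   + (- A *m (Dd + A *m Dx + Dx *m B) + (Dd + A *m Dx + Dx *m B) *m - B + - A *m Dx *m - B))
  = frame_curvature.
Proof.
rewrite !mulmxDr !mulmxDl !mulNmx !mulmxN !mulNmx !opprK !mulmxA.
rewrite /frame_curvature /Dy /Dx /Dd !mulmxA !(mxdotDr, mxdotNr, mxdotZr).
rewrite (mxdot_rdiag_skewl d y As) (mxdot_rdiag_skewr m d y Bs).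
by field.
Qed.

(** Along the curves through X0 that rotate the frames with velocities A and B
    and move the diagonal by e, f o sigma sees only x + t e. *)
Lemma second_subderivative_sigma_le :
  (second_subderivative (fun X => f (sigma X)) X0 Y H <=
   second_subderivative f x y d + frame_curvature%:E)%E.
Proof.
have lim : (fun te : R * 'cV[R]_n => 2 * mxdot Dy ((te.1 ^+ 2)^-1 *:
    (spin A te.1 *m (Dx + te.1 *: rdiag m te.2) *m spin B te.1 - Dx
     - te.1 *: (rdiag m te.2 + A *m Dx + Dx *m B)))) @ dirs d --> - frame_curvature.
  rewrite -curv2; apply: cvgM; first exact: cvg_cst.
  apply: cvg_mxdot; first exact: cvg_cst.
  exact: (spin_expansion2 (dirs_fst d) As Bs rdiag_cvg (dirs_neq0 d)).
apply: limf_einf_le => c; rewrite -lteBrDr// -EFinB => cl P PH.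
have [c1 lc1 c1c] := exists_EFin_between cl.
rewrite lte_fin in c1c.
have P1 : \forall te \near dirs d, P (te.1, te.1^-1 *: (curve te.1 te.2 - X0)).
  have cc : (fun te : R * 'cV[R]_n => (te.1, te.1^-1 *: (curve te.1 te.2 - X0))) @ dirs d --> dirs H.
    by apply: cvg_dirs; [exact: dirs_fst|exact: dirs_gt0|exact: curve_cvg].
  exact: cc PH.
have P2 := dirs_gt0 d.
have P3 : \forall te \near dirs d, - (c - c1) <= 2 * mxdot Dy ((te.1 ^+ 2)^-1 *:
    (spin A te.1 *m (Dx + te.1 *: rdiag m te.2) *m spin B te.1 - Dx
     - te.1 *: (rdiag m te.2 + A *m Dx + Dx *m B))).
  by apply: cvgr_ge lim _ _; lra.
have [[t e] /= [[Pt t0] ct] fte] := limf_einf_lt lc1 (filterI (filterI P1 P2) P3).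
eexists; first exact: Pt.
have es : X0 + t *: (t^-1 *: (curve t e - X0)) = curve t e.
  by rewrite scalerA mulfV ?lt0r_neq0// scale1r addrC subrK.
rewrite /= es sigmaX0 {1}curveE abs_sym_rdiag//.
have [a fa] : exists a, f x = a%:E by exists (fine (f x)); rewrite fineK.
rewrite fa in fte *.
have -> : c = c1 + (c - c1) by lra.
apply: (ge_quotient_shift (p := t * mxdot y e)) (ltW fte).
  by rewrite mulr_gt0// ?exprn_gt0// invr_gt0.
rewrite -(mxdotZr t Y) scalerA mulfV ?lt0r_neq0// scale1r.
have -> : mxdot Y (curve t e - X0) =
    mxdot Dy (spin A t *m (Dx + t *: rdiag m e) *m spin B t - Dx).
  by rewrite /Y /curve /X0 -mulmxBl -mulmxBr mxdot_orth.
move: ct; rewrite mxdotZr !(mxdotDr, mxdotNr, mxdotZr).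
rewrite mxdot_rdiag_skewl// mxdot_rdiag_skewr// (mxdot_rdiag2 hnm y e) !addr0.
set Z := mxdot Dy (_ *m spin B t); move: Z (mxdot y e) (mxdot Dy Dx) => Z ye xy ct.
have : - (c - c1) * t ^+ 2 <= 2 * (Z - xy - t * ye).
  by rewrite -ler_pdivlMr ?exprn_gt0// -mulrA [_ / t ^+ 2]mulrC.
lra.
Qed.

(** Undoing the rotation of the frames turns an arbitrary matrix close to X0 + t H
    into one that is nearly diagonal, and by von Neumann's inequality its pairing
    with Y is at most that of the singular values. *)
Lemma second_subderivative_sigma_ge :
  (second_subderivative f x y d + frame_curvature%:E <=
   second_subderivative (fun X => f (sigma X)) X0 Y H)%E.
Proof.
pose h := Dd + A *m Dx + Dx *m B.
pose W (tw : R * 'M[R]_(m, n)) := U^T *m tw.2 *m V.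
have Wh : W @ dirs H --> h.
  have -> : h = U^T *m H *m V.
    by rewrite /H !mulmxA Uo mul1mx -mulmxA Vo mulmx1.
  apply: cvg_mulmx; last exact: cvg_cst.
  by apply: cvg_mulmx; [exact: cvg_cst|exact: dirs_snd].
pose Z (tw : R * 'M[R]_(m, n)) := spin (- A) tw.1 *m (Dx + tw.1 *: W tw) *m spin (- B) tw.1
   - Dx - tw.1 *: (W tw + - A *m Dx + Dx *m - B).
have lim : (fun tw => 2 * mxdot Dy ((tw.1 ^+ 2)^-1 *: Z tw)) @ dirs H --> frame_curvature.
  rewrite -curv2N; apply: cvgM; first exact: cvg_cst.
  apply: cvg_mxdot; first exact: cvg_cst.
  exact: (spin_expansion2 (dirs_fst H) (skewsymN As) (skewsymN Bs) Wh (dirs_neq0 H)).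
apply: le_limf_einf => c; rewrite -lteBlDr// -EFinB => cl.
have [c1 cc1 c1l] := exists_EFin_between cl; rewrite lte_fin in cc1.
pose e (tw : R * 'M[R]_(m, n)) := tw.1^-1 *: (sigma (X0 + tw.1 *: tw.2) - x).
have fe : \forall tw \near dirs H, (c1%:E < (f (x + tw.1 *: e tw)%R - f x
    - (tw.1 * mxdot y (e tw))%:E) * ((2^-1 * tw.1 ^+ 2)^-1)%:E)%E.
  have ce : (fun tw => (tw.1, e tw)) @ dirs H --> dirs d.
    by apply: cvg_dirs; [exact: dirs_fst|exact: dirs_gt0|exact: sigma_hadamard].
  exact: ce (lt_limf_einf c1l).
near=> tw.
have t0 : 0 < tw.1 by near: tw; exact: dirs_gt0.
have ze : c - c1 <= 2 * mxdot Dy ((tw.1 ^+ 2)^-1 *: Z tw).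
  by near: tw; apply: cvgr_ge lim _ _; lra.
have ft : (c1%:E < (f (x + tw.1 *: e tw)%R - f x
    - (tw.1 * mxdot y (e tw))%:E) * ((2^-1 * tw.1 ^+ 2)^-1)%:E)%E by near: tw.
have se : x + tw.1 *: e tw = sigma (X0 + tw.1 *: tw.2).
  by rewrite /e scalerA mulfV ?lt0r_neq0// scale1r addrC subrK.
rewrite se in ft; rewrite sigmaX0.
have -> : c = c1 + (c - c1) by lra.
have [a fa] : exists a, f x = a%:E by exists (fine (f x)); rewrite fineK.
rewrite fa in ft *.
apply: (le_quotient_shift (p := tw.1 * mxdot y (e tw))) (ltW ft).
  by rewrite mulr_gt0// ?exprn_gt0// invr_gt0.
have trace : mxdot Dy (spin (- A) tw.1 *m (Dx + tw.1 *: W tw) *m spin (- B) tw.1)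
    <= mxdot y (sigma (X0 + tw.1 *: tw.2)).
  rewrite [leRHS]mxdotC.
  apply: le_trans (von_neumann hnm _ (Ut tw.1) (Vt tw.1) ys).
  have -> : X0 + tw.1 *: tw.2 = U *m (Dx + tw.1 *: W tw) *m V^T.
    rewrite mulmxDr mulmxDl -/X0 -scalemxAr -scalemxAl /W !mulmxA orthogonal_mxC//.
    by rewrite mul1mx -mulmxA orthogonal_mxC// mulmx1.
  have -> : U *m spin A tw.1 *m rdiag m y *m (V *m (spin B tw.1)^T)^T =
      U *m (spin A tw.1 *m Dy *m spin B tw.1) *m V^T.
    by rewrite trmx_mul trmxK !mulmxA.
  by rewrite mxdot_orth// !spinN// [leRHS]mxdotC mxdot_mulr mxdot_mull !mulmxA.
have -> : tw.1 * mxdot y (e tw) = mxdot y (sigma (X0 + tw.1 *: tw.2)) - mxdot Dy Dx.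
  by rewrite -mxdotZr /e scalerA mulfV ?lt0r_neq0// scale1r mxdotBr mxdot_rdiag2.
have -> : mxdot Y tw.2 = mxdot Dy (W tw).
  by rewrite /Y mxdot_mulr trmxK mxdot_mull mulmxA.
move: ze; rewrite mxdotZr /Z !mulNmx !mulmxN !(mxdotDr, mxdotNr, mxdotZr).
rewrite (mxdot_rdiag_skewl x y As) (mxdot_rdiag_skewr m x y Bs) !oppr0 !addr0.
move: trace; set p := mxdot Dy (_ *m _); set p' := mxdot y (sigma _).
move: p p' (mxdot Dy Dx) (mxdot Dy (W tw)) => p p' q r pp ze.
have : (c - c1) * tw.1 ^+ 2 <= 2 * (p - q - tw.1 * r).
  by rewrite -ler_pdivlMr ?exprn_gt0// -mulrA [_ / tw.1 ^+ 2]mulrC.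
lra.
Unshelve. all: by end_near. Qed.

End SecondOrderChainRule.

(** * Critical directions *)

Section CriticalDirections.
Context {R : realType} {m n : nat}.
Variable hnm : (n <= m)%N.
Local Notation w := (widen_ord hnm).

Lemma near_affine_ge0 (a b : R) : 0 <= a -> (a = 0 -> 0 <= b) ->
  \forall t \near 0^'+, 0 <= a + t * b.
Proof.
rewrite le0r => /predU1P[->|a0] b0.
  by near=> t; rewrite add0r mulr_ge0 ?b0// ltW.
have lim : (fun t => a + t * b) @ (0 : R)^'+ --> a + 0 * b.
  apply: cvgD; first exact: cvg_cst.
  by apply: cvgMl; exact: cvg_at_right_filter.
rewrite mul0r addr0 in lim.
exact: (cvgr_ge _ lim).
Unshelve. all: by end_near. Qed.

(** Along an adapted direction the moving diagonal remains a vector of singular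
    values: inequalities that are strict at x persist, and ties are resolved by the
    order of the velocities. *)
Lemma adapted_sorted_near (x : 'cV[R]_n) h : sorted_nneg x -> adapted hnm x h ->
  \forall t \near 0^'+, sorted_nneg (x + t *: \col_i h (w i) i).
Proof.
move=> [x0 xs] ah.
have nn : \forall t \near (0 : R)^'+, forall i, 0 <= x i 0 + t * h (w i) i.
  by apply: filter_forall => i; apply: near_affine_ge0 => // /(adapted_ge0 ah).
have srt : \forall t \near (0 : R)^'+, forall ij : 'I_n * 'I_n, (ij.1 <= ij.2)%N ->
    x ij.2 0 + t * h (w ij.2) ij.2 <= x ij.1 0 + t * h (w ij.1) ij.1.
  apply: filter_forall => -[i j] /=.
  have [ij|_] := leqP i j; last by near=> t.
  have : \forall t \near (0 : R)^'+, 0 <= x i 0 - x j 0 + t * (h (w i) i - h (w j) j).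
    apply: near_affine_ge0; first by rewrite subr_ge0 xs.
    by move=> /eqP; rewrite subr_eq0 subr_ge0 => /eqP /(adapted_le ah ij).
  by apply: filterS => t tp _; lra.
near=> t; split=> [i|i j ij]; rewrite !mxE.
  by move: i; near: t.
have : forall ij : 'I_n * 'I_n, (ij.1 <= ij.2)%N ->
    x ij.2 0 + t * h (w ij.2) ij.2 <= x ij.1 0 + t * h (w ij.1) ij.1 by near: t.
by move=> /(_ (i, j)); exact.
Unshelve. all: by end_near. Qed.

Lemma sigma_orth (Q1 : 'M[R]_m) (Q2 : 'M[R]_n) X :
  orthogonal_mx Q1 -> orthogonal_mx Q2 -> sigma (Q1 *m X *m Q2^T) = sigma X.
Proof.
move=> u1 u2; have [P1 [P2 [p1 p2 XE]]] := svd_exists hnm X.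
have -> : Q1 *m X *m Q2^T = (Q1 *m P1) *m rdiag m (sigma X) *m (Q2 *m P2)^T.
  by rewrite {1}XE trmx_mul !mulmxA.
by apply: sigma_rdiag_sorted => //; [exact: orthogonal_mxM..|exact: sigma_sorted].
Qed.

Variables (f : 'cV[R]_n -> \bar R) (X0 Y : 'M[R]_(m, n)) (U : 'M[R]_m) (V : 'M[R]_n).
Hypotheses (fsym : absolutely_symmetric f).
Let fs (X : 'M[R]_(m, n)) := f (sigma X).
Variables (x y : 'cV[R]_n).
Hypotheses (xs : sorted_nneg x) (ys : sorted_nneg y).
Hypotheses (Uo : orthogonal_mx U) (Vo : orthogonal_mx V).
Hypotheses (X0E : X0 = U *m rdiag m x *m V^T) (YE : Y = U *m rdiag m y *m V^T).
Hypothesis Ysub : subdifferential fs X0 Y.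

(** f o sigma is invariant under the motions of the singular frames that fix X0,
    hence so is its subdifferential at X0. *)
Lemma subdifferential_stab Q : stab x Q ->
  subdifferential fs X0 (U *m (Q.1 *m rdiag m y *m Q.2^T) *m V^T).
Proof.
move=> Qx; have [u1 u2 _] := Qx; case: Ysub => fin sub; split => // X.
pose P1 := U *m Q.1 *m U^T; pose P2 := V *m Q.2 *m V^T.
have p1 : orthogonal_mx P1 by apply: orthogonal_mxM; [exact: orthogonal_mxM|exact: orthogonal_mxT].
have p2 : orthogonal_mx P2 by apply: orthogonal_mxM; [exact: orthogonal_mxM|exact: orthogonal_mxT].
have PE z : P1 *m (U *m rdiag m z *m V^T) *m P2^T = U *m (Q.1 *m rdiag m z *m Q.2^T) *m V^T.
  rewrite /P1 /P2 !trmx_mul !trmxK !mulmxA -(mulmxA _ U^T U) Uo mulmx1.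
  by rewrite -(mulmxA _ V^T V) Vo mulmx1.
have PX0 : P1 *m X0 *m P2^T = X0 by rewrite {1}X0E PE (stabE Qx) -X0E.
rewrite -PE -YE.
have := sub (P1^T *m X *m P2).
have -> : fs (P1^T *m X *m P2) = fs X.
  rewrite /fs -[P2 in LHS]trmxK sigma_orth//; exact: orthogonal_mxT.
suff -> : mxdot (P1 *m Y *m P2^T) (X - X0) = mxdot Y (P1^T *m X *m P2 - X0) by [].
rewrite !mxdotBr; congr (_ - _); last by rewrite -{1}PX0 mxdot_orth.
by rewrite mxdot_mulr trmxK mxdot_mull mulmxA.
Qed.

Let stab_conj p (Q S : 'M[R]_p) : skewsym S -> skewsym (Q *m S *m Q^T).
Proof. by move=> Ss; rewrite /skewsym !trmx_mul trmxK Ss mulNmx mulmxN mulmxA. Qed.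

(** Along a critical direction H, Y is among the motions of Y by the stabilizer
    of X0 one that is best aligned with H, so that a single pair of frames
    decomposes X0, Y and the first-order motion of the singular values along H. *)
Theorem critical_expansion H : critical_cone fs X0 Y H ->
  exists (A : 'M[R]_m) (B : 'M[R]_n) (D : 'M[R]_(m, n)),
  [/\ skewsym A /\ skewsym B,
      U^T *m H *m V = D + A *m rdiag m x + rdiag m x *m B,
      (D *m (rdiag m x)^T)^T = D *m (rdiag m x)^T,
      ((rdiag m x)^T *m D)^T = (rdiag m x)^T *m D
    & second_subderivative fs X0 Y H =
      (second_subderivative f x y (dsigma X0 H) + (frame_curvature x y A B)%:E)%E].
Proof.
move=> Hcrit; set h := U^T *m H *m V.
have HE : H = U *m h *m V^T.
  by rewrite /h !mulmxA orthogonal_mxC// mul1mx -mulmxA orthogonal_mxC// mulmx1.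
have hmax Q : stab x Q -> mxdot (Q.1^T *m h *m Q.2) (rdiag m y) <= mxdot h (rdiag m y).
  move=> Qx; have := subgradient_le_subderivative H (subdifferential_stab Qx).
  rewrite Hcrit lee_fin YE HE !mxdot_orth// => le1.
  by rewrite mxdot_mulr mxdot_mull trmxK mulmxA mxdotC (mxdotC h).
have [Q [Qx Qy ah]] := adapted_frame hnm ys.1 ys.2 hmax.
have [A [B [As Bs hE]]] := adapted_decomposition xs.1 ah.
have [u1 u2 Qxe] := Qx.
set h' := Q.1^T *m h *m Q.2 in ah hE; set d := \col_i h' (w i) i in hE.
have xds := adapted_sorted_near xs ah; rewrite -/d in xds.
pose Dx := rdiag m x; pose Dy := rdiag m y; pose Dd := rdiag m d.
have QUo : orthogonal_mx (U *m Q.1) by exact: orthogonal_mxM.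
have QVo : orthogonal_mx (V *m Q.2) by exact: orthogonal_mxM.
have QE z : stab z Q -> U *m rdiag m z *m V^T = U *m Q.1 *m rdiag m z *m (V *m Q.2)^T.
  by move=> Qz; rewrite -{1}(stabE Qz) trmx_mul !mulmxA.
have hE' : h = Q.1 *m (Dd + A *m Dx + Dx *m B) *m Q.2^T.
  rewrite -hE /h' !mulmxA orthogonal_mxC// mul1mx.
  by rewrite -mulmxA orthogonal_mxC// mulmx1.
have HQ : H = U *m Q.1 *m (Dd + A *m Dx + Dx *m B) *m (V *m Q.2)^T.
  by rewrite HE hE' trmx_mul !mulmxA.
have fx : f x \is a fin_num.
  by case: Ysub => + _; rewrite /fs X0E (sigma_rdiag_sorted hnm Uo Vo xs).
have X0Q := etrans X0E (QE _ Qx); have YQ := etrans YE (QE _ Qy).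
have dE : dsigma X0 H = d.
  by have := dsigma_frame hnm xs xds QUo QVo As Bs; rewrite -HQ -X0Q.
have second : second_subderivative fs X0 Y H =
    (second_subderivative f x y d + (frame_curvature x y A B)%:E)%E.
  apply/eqP; rewrite eq_le; apply/andP; split.
    have := second_subderivative_sigma_le hnm y d fsym fx xs QUo QVo As Bs.
    by rewrite -HQ -X0Q -YQ.
  have := second_subderivative_sigma_ge hnm fx xs ys xds QUo QVo As Bs.
  by rewrite -HQ -X0Q -YQ.
have QDx : Q.1 *m Dx *m Q.2^T = Dx by exact: stabE.
have QDy : Q.1 *m Dy *m Q.2^T = Dy by exact: stabE.
have Q1Dx : Q.1^T *m Dx = Dx *m Q.2^T.
  by rewrite -{1}QDx !mulmxA u1 mul1mx.
have Q1A (M : 'M[R]_m) : Q.1 *m M *m Q.1^T *m Dx = Q.1 *m (M *m Dx) *m Q.2^T.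
  by rewrite -mulmxA Q1Dx !mulmxA.
have Q2B (M : 'M[R]_n) : Dx *m (Q.2 *m M *m Q.2^T) = Q.1 *m (Dx *m M) *m Q.2^T.
  by rewrite !mulmxA -Qxe.
exists (Q.1 *m A *m Q.1^T), (Q.2 *m B *m Q.2^T), (Q.1 *m Dd *m Q.2^T); split.
- by split; exact: stab_conj.
- by rewrite Q1A Q2B -!mulmxDl -!mulmxDr.
- rewrite -/Dx -QDx !trmx_mul !trmxK !mulmxA.
  have e (M N : 'M[R]_(m, n)) : Q.1 *m M *m Q.2^T *m Q.2 *m N^T *m Q.1^T =
      Q.1 *m (M *m N^T) *m Q.1^T.
    by rewrite -(mulmxA _ Q.2^T) u2 mulmx1 !mulmxA.
  by rewrite !e /Dx /Dd rdiag_mulC.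
- rewrite -/Dx -QDx !trmx_mul !trmxK !mulmxA.
  have e (M N : 'M[R]_(m, n)) : Q.2 *m M^T *m Q.1^T *m Q.1 *m N *m Q.2^T =
      Q.2 *m (M^T *m N) *m Q.2^T.
    by rewrite -(mulmxA _ Q.1^T) u1 mulmx1 !mulmxA.
  by rewrite !e /Dx /Dd rdiag_mulTC.
- rewrite dE second; congr (_ + _%:E)%E.
  rewrite /frame_curvature -/Dx -/Dy; congr (- _).
  rewrite -{1}(mxdot_orth Dy _ u1 u2) QDy; congr mxdot.
  have -> : Q.1 *m A *m Q.1^T *m (Q.1 *m A *m Q.1^T) = Q.1 *m (A *m A) *m Q.1^T.
    by rewrite !mulmxA -(mulmxA _ Q.1^T) u1 mulmx1.
  have -> : Q.2 *m B *m Q.2^T *m (Q.2 *m B *m Q.2^T) = Q.2 *m (B *m B) *m Q.2^T.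
    by rewrite !mulmxA -(mulmxA _ Q.2^T) u2 mulmx1.
  rewrite !Q1A Q2B !(mulmxDl, mulmxDr) -scalemxAr -scalemxAl; congr (_ + _ *: _).
  by rewrite !mulmxA -(mulmxA _ Q.2^T) u2 mulmx1.
Qed.

End CriticalDirections.

(** * Rank and index sets *)

Section IndexSums.
Context {R : realType}.

(** This and the next lemma locate the columns of the block matrix P: its first two
    blocks list the indices below the rank and those from the rank on, increasingly. *)
Lemma val_enum_prefix n r (a : 'I_#|[set s : 'I_n | (s < r)%N]%SET|) : (r <= n)%N ->
  val (enum_val a) = a :> nat.
Proof.
move=> rn; have [i0 _] : exists i0 : 'I_n, true by exists (enum_val a).
have E : map val (enum [set s : 'I_n | (s < r)%N]%SET) = iota 0 r.
  have -> : enum [set s : 'I_n | (s < r)%N]%SET = [seq s : 'I_n <- enum 'I_n | (s < r)%N].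
    by rewrite [in RHS]enumT {1}/enum_mem; apply: eq_filter => s; rewrite !inE.
  rewrite -(filter_map val (fun v => (v < r)%N)) val_enum_ord -(subnKC rn) iotaD filter_cat.
  rewrite (_ : seq.filter _ (iota 0 r) = iota 0 r); last first.
    by apply/all_filterP/allP => v; rewrite mem_iota.
  rewrite (_ : seq.filter _ _ = [::]) ?cats0//.
  apply/eqP; rewrite -[_ == _]negbK -has_filter -all_predC; apply/allP => v.
  by rewrite mem_iota /= add0n -leqNgt => /andP[].
rewrite (enum_val_nth i0) -(nth_map _ 0%N) ?E; last by rewrite -cardE.
have : (a < size (iota 0 r))%N by rewrite -E size_map -cardE.
by rewrite size_iota => ar; rewrite nth_iota.
Qed.

Lemma val_enum_suffix n r (a : 'I_#|[set s : 'I_n | (r <= s)%N]%SET|) : (r <= n)%N ->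
  val (enum_val a) = (r + a)%N :> nat.
Proof.
move=> rn; have [i0 _] : exists i0 : 'I_n, true by exists (enum_val a).
have E : map val (enum [set s : 'I_n | (r <= s)%N]%SET) = iota r (n - r).
  have -> : enum [set s : 'I_n | (r <= s)%N]%SET = [seq s : 'I_n <- enum 'I_n | (r <= s)%N].
    by rewrite [in RHS]enumT {1}/enum_mem; apply: eq_filter => s; rewrite !inE.
  rewrite -(filter_map val (fun v => (r <= v)%N)) val_enum_ord -{1}(subnKC rn) iotaD filter_cat.
  rewrite add0n (_ : seq.filter _ (iota r _) = iota r (n - r)); last first.
    by apply/all_filterP/allP => v; rewrite mem_iota => /andP[].
  rewrite (_ : seq.filter _ _ = [::])//.
  apply/eqP; rewrite -[_ == _]negbK -has_filter -all_predC; apply/allP => v.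
  by rewrite mem_iota /= add0n -ltnNge.
rewrite (enum_val_nth i0) -(nth_map _ 0%N) ?E; last by rewrite -cardE.
have : (a < size (iota r (n - r)))%N by rewrite -E size_map -cardE.
by rewrite size_iota => ar; rewrite nth_iota.
Qed.

Lemma card_prefix n r : (r <= n)%N -> #|[set s : 'I_n | (s < r)%N]%SET| = r.
Proof.
move=> rn; rewrite -sum1_card; under eq_bigl do rewrite inE.
by rewrite -(big_ord_widen n (fun=> 1%N) rn) sum1_card card_ord.
Qed.

Lemma sum_enum_val_split n (P : pred 'I_n) (F : 'I_n -> R) (A B : {set 'I_n}) :
  B = ~: A ->
  \sum_(a < #|A| | P (enum_val a)) F (enum_val a)
  + \sum_(b < #|B| | P (enum_val b)) F (enum_val b) = \sum_(k | P k) F k.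
Proof.
move=> ->.
rewrite -!big_enum_val_cond /=.
rewrite [RHS](bigID (mem A)) /=; congr (_ + _).
  by apply: eq_bigl => k; rewrite andbC.
by apply: eq_bigl => k; rewrite inE andbC.
Qed.

End IndexSums.

Section RankOfSingularValues.
Context {R : realType} {m n : nat}.
Variable hnm : (n <= m)%N.
Local Notation w := (widen_ord hnm).

Lemma sorted_support (x : 'cV[R]_n) : sorted_nneg x ->
  exists2 c, (c <= n)%N & forall s : 'I_n, (s < c)%N = (x s 0 != 0).
Proof.
move=> [x0 xs].
pose P c := [forall s : 'I_n, (c <= s)%N ==> (x s 0 == 0)].
have Pn : P n by apply/forallP => s; rewrite leqNgt ltn_ord.
have exP : exists c, P c by exists n.
case: (ex_minnP exP) => c Pc minc; exists c; first exact: minc.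
move=> s; apply/idP/idP => [sc|]; last first.
  by apply: contraR; rewrite -leqNgt => cs; move/forallP: Pc => /(_ s) /implyP; exact.
apply: contraL sc => /eqP xs0; rewrite -leqNgt; apply: minc; apply/forallP => k.
by apply/implyP => sk; rewrite eq_le x0 andbT -xs0 xs.
Qed.

(** Dividing each column by its nonzero diagonal entry leaves a partial identity. *)
Lemma rank_rdiag (x : 'cV[R]_n) c : (c <= n)%N ->
  (forall s : 'I_n, (s < c)%N = (x s 0 != 0)) -> \rank (rdiag m x) = c.
Proof.
move=> cn xc; pose x' : 'rV[R]_n := \row_i (if x i 0 == 0 then 1 else x i 0).
have -> : rdiag m x = (pid_mx c : 'M[R]_(m, n)) *m diag_mx x'.
  apply/matrixP => i j; rewrite mul_mx_diag !mxE.
  case: (nat_of_ord i =P j) => ij /=; last by rewrite mul0r.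
  rewrite ij xc.
  by case: eqP => [->|_]; rewrite ?mul0r ?mul1r.
rewrite mxrankMfree; first by rewrite rank_pid_mx// (leq_trans cn).
rewrite row_free_unit unitmxE det_diag unitfE prodf_seq_neq0; apply/allP => i _ /=.
by rewrite mxE; case: ifPn => // _; exact: oner_neq0.
Qed.

Lemma rank_orth_rdiag (U : 'M[R]_m) (V : 'M[R]_n) (x : 'cV[R]_n) (s : 'I_n) :
  orthogonal_mx U -> orthogonal_mx V -> sorted_nneg x ->
  (s < \rank (U *m rdiag m x *m V^T))%N = (x s 0 != 0).
Proof.
move=> Uo Vo xs; have [c cn xc] := sorted_support xs.
have Uu : U \in unitmx by case/mulmx1_unit: Uo.
have Vu : V^T \in unitmx by case/mulmx1_unit: Vo.
rewrite mxrankMfree ?row_free_unit// -mxrank_tr trmx_mul mxrankMfree; last first.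
  by rewrite row_free_unit unitmx_tr.
by rewrite mxrank_tr (rank_rdiag cn xc).
Qed.

End RankOfSingularValues.

(** * Explicit form of the frame curvature *)

Section ExplicitFormula.
Context {R : realType} {m n : nat}.
Variable hnm : (n <= m)%N.
Local Notation w := (widen_ord hnm).
Variables (X0 Y H : 'M[R]_(m, n)) (U : 'M[R]_m) (V : 'M[R]_n) (x y : 'cV[R]_n).
Hypotheses (sX0 : sigma X0 = x) (sY : sigma Y = y).
Hypotheses (Uo : orthogonal_mx U) (Vo : orthogonal_mx V).
Hypothesis X0E : X0 = U *m rdiag m x *m V^T.
Let h := U^T *m H *m V.

Let xs : sorted_nneg x. Proof. by rewrite -sX0; exact: sigma_sorted. Qed.

Let alphaE s : (s \in alpha X0) = (x s 0 != 0).
Proof. by rewrite inE X0E rank_orth_rdiag. Qed.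

Let betaE s : (s \in beta X0) = (x s 0 == 0).
Proof. by rewrite inE leqNgt X0E rank_orth_rdiag// negbK. Qed.

Let beta_setC : beta X0 = ~: alpha X0.
Proof. by apply/setP => s; rewrite finset.in_setC betaE alphaE negbK. Qed.

Definition bil (M : 'M[R]_(m, n)) (a : 'cV[R]_m) (b : 'cV[R]_n) : R := (a^T *m M *m b) 0 0.

Lemma bilNl M a b : bil M (- a) b = - bil M a b.
Proof. by rewrite /bil [(- _)^T]linearN /= !mulNmx mxE. Qed.

Lemma bilZl M c a b : bil M (c *: a) b = c * bil M a b.
Proof. by rewrite /bil [(_ *: _)^T]linearZ /= -!scalemxAl mxE. Qed.

Lemma bil0r M a : bil M a 0 = 0.
Proof. by rewrite /bil mulmx0 mxE. Qed.

Lemma mulmx_bil N N' (M : 'M[R]_(m, n)) (P : 'M[R]_(m, N)) (Q : 'M[R]_(n, N')) i j :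
  (P^T *m M *m Q) i j = bil M (col i P) (col j Q).
Proof.
rewrite /bil !mxE; apply: eq_bigr => k _; rewrite [col j Q k 0]mxE; congr (_ * _).
by rewrite !mxE; apply: eq_bigr => l _; rewrite !mxE.
Qed.

Lemma bil_col M i j : bil M (col i U) (col j V) = (U^T *m M *m V) i j.
Proof. by rewrite mulmx_bil. Qed.

(** bigB M pairs the upper half of a column with the lower half of the other. *)
Lemma quad_bigB N N' (M : 'M[R]_(m, n)) (P : 'M[R]_(m, N)) (Q : 'M[R]_(n, N))
    (P' : 'M[R]_(m, N')) (Q' : 'M[R]_(n, N')) i j :
  (((Num.sqrt 2)^-1 *: col_mx P Q)^T *m bigB M *m ((Num.sqrt 2)^-1 *: col_mx P' Q')) i j =
  2^-1 * (bil M (col i P) (col j Q') + bil M (col j P') (col i Q)).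
Proof.
rewrite [(_ *: _)^T]linearZ /= -!scalemxAl -scalemxAr scalerA -invfM -expr2 sqr_sqrtr//.
rewrite mxE; congr (_ * _); rewrite tr_col_mx /bigB mul_row_block !mulmx0 add0r addr0.
rewrite mul_row_col mxE addrC; congr (_ + _); first exact: mulmx_bil.
have -> : Q^T *m M^T *m P' = (P'^T *m M *m Q)^T by rewrite !trmx_mul trmxK mulmxA.
by rewrite mxE mulmx_bil.
Qed.

(** The contribution of an eigenvector column (a, b) of bigB X0 to the alpha term. *)
Definition column_term (mu : R) (l : 'I_n) (a : 'cV[R]_m) (b : 'cV[R]_n) : R :=
  (2^-1 * (bil H (col (w l) U) b + bil H a (col l V))) ^+ 2 / (mu - bil X0 a b).

Lemma diag_conj_entry N N' (G : 'M[R]_(N, N')) (d : 'rV[R]_N') k :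
  (G *m diag_mx d *m G^T) k k = \sum_j G k j ^+ 2 * d 0 j.
Proof.
rewrite mxE; apply: eq_bigr => j _; rewrite mul_mx_diag !mxE; ring.
Qed.

Lemma invmx_diag N (d : 'rV[R]_N) : (forall j, d 0 j != 0) ->
  invmx (diag_mx d) = diag_mx (\row_j (d 0 j)^-1).
Proof.
move=> d0; have du : diag_mx d \in unitmx.
  by rewrite unitmxE det_diag unitfE prodf_seq_neq0; apply/allP => i _ /=.
apply: (can_inj (mulKmx du)); rewrite mulmxV//; apply/matrixP => i j.
rewrite mul_diag_mx !mxE; case: (i =P j) => [->|_]; last by rewrite mulr0n mulr0.
by rewrite !mulr1n mulfV.
Qed.

Lemma mxdot_Sigma_sub (I : {set 'I_n}) (M : 'M[R]_#|I|) :
  mxdot (mxsub (widx hnm (I := I)) (idx (I := I)) (Sigma Y)) M =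
  \sum_(k < #|I|) y (enum_val k) 0 * M k k.
Proof.
rewrite mxdotE; apply: eq_bigr => k _; rewrite (bigD1 k)//= big1 ?addr0 => [|l lk].
  by rewrite !mxE /= eqxx sY.
rewrite !mxE /= ifF ?mul0r//; apply/eqP => /val_inj /enum_val_inj kl.
by rewrite kl eqxx in lk.
Qed.

Local Notation al := (alpha X0).
Local Notation be := (beta X0).
Local Notation be0 := (@beta0 m n).
Local Notation Ucols I := (colsub (widx hnm (I := I)) U).
Local Notation Vcols I := (colsub (idx (I := I)) V).

Let Pu : 'M[R]_(m, Pcols X0) :=
  row_mx (Ucols al) (row_mx (Ucols be)
      (row_mx (Num.sqrt 2 *: colsub (enum_val : 'I_#|be0| -> 'I_m) U)
        (row_mx (- Ucols al) (- Ucols be)))).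
Let Pv : 'M[R]_(n, Pcols X0) :=
  row_mx (Vcols al) (row_mx (Vcols be)
      (row_mx 0 (row_mx (Vcols al) (Vcols be)))).

Let PmxE : Pmx hnm X0 U V = (Num.sqrt 2)^-1 *: col_mx Pu Pv.
Proof. by []. Qed.

(** The columns of P are eigenvectors of bigB X0, so the resolvent is diagonal and the
    trace splits over the kept columns; the two factors bigB H are transposed to
    each other, which gives squares. *)
Lemma alpha_term_columns mu :
  (forall j, j \in Pkeep X0 (alpha_ X0 mu) -> mu - bil X0 (col j Pu) (col j Pv) != 0) ->
  alpha_term hnm X0 U V Y H mu =
  \sum_(l in alpha_ X0 mu) y l 0 *
    \sum_(j in Pkeep X0 (alpha_ X0 mu)) column_term mu l (col j Pu) (col j Pv).
Proof.
move=> mu0; rewrite /alpha_term; set I := alpha_ X0 mu in mu0 *.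
set G := (P_ hnm U V I)^T *m bigB H *m Pc hnm X0 U V I.
have GT : (Pc hnm X0 U V I)^T *m bigB H *m P_ hnm U V I = G^T.
  have Bs : (bigB H)^T = bigB H by rewrite /bigB tr_block_mx !trmx0 trmxK.
  by rewrite /G !trmx_mul trmxK Bs mulmxA.
have GE k j : G k j = 2^-1 * (bil H (col (w (enum_val k)) U) (col (enum_val j) Pv)
    + bil H (col (enum_val j) Pu) (col (enum_val k) V)).
  have -> : G = colsub enum_val ((P_ hnm U V I)^T *m bigB H *m Pmx hnm X0 U V).
    apply/matrixP => a b; rewrite [RHS]mxE [LHS]mxE [RHS]mxE; apply: eq_bigr => i _.
    by rewrite [Pc _ _ _ _ _ _ _]mxE.
  rewrite mxE /P_ PmxE quad_bigB; congr (_ * (bil _ _ _ + bil _ _ _)).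
    by apply/colP => i; rewrite !mxE.
  by apply/colP => i; rewrite !mxE.
have LE j : ((Pmx hnm X0 U V)^T *m bigB X0 *m Pmx hnm X0 U V) j j =
    bil X0 (col j Pu) (col j Pv).
  by rewrite PmxE quad_bigB; field.
have -> : mu%:M - Lam hnm X0 U V I =
    diag_mx (\row_j (mu - bil X0 (col (enum_val j) Pu) (col (enum_val j) Pv))).
  apply/matrixP => a b; rewrite /Lam [LHS]mxE [X in _ + X]mxE.
  rewrite [in LHS]mxE [X in _ - X]mxE [X in _ - X *+ _]mxE LE [RHS]mxE [X in _ = X *+ _]mxE.
  by rewrite mulrnBl.
rewrite invmx_diag => [|j]; last by rewrite mxE mu0// enum_valP.
set D := diag_mx _.
have -> : G *m D *m (Pc hnm X0 U V I)^T *m bigB H *m P_ hnm U V I = G *m D *m G^T.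
  by rewrite -GT !mulmxA.
rewrite mxdot_Sigma_sub [RHS]big_enum_val; apply: eq_bigr => k _; congr (_ * _).
rewrite diag_conj_entry [RHS]big_enum_val; apply: eq_bigr => j _.
by rewrite GE !mxE.
Qed.

Let rank_le : (\rank X0 <= n)%N. Proof. exact: rank_leq_col. Qed.

Let Pkeep_lt (I : {set 'I_n}) (j : 'I_(Pcols X0)) (s : 'I_n) :
  j = s :> nat -> (j \in Pkeep X0 I) = (s \notin I).
Proof.
move=> js; rewrite inE; congr (~~ _); apply/existsP/idP => [[k /andP[kI /eqP kj]]|sI].
  by rewrite (_ : s = k)//; apply: val_inj; rewrite /= -js.
by exists s; rewrite sI js eqxx.
Qed.

Let Pkeep_ge (I : {set 'I_n}) (j : 'I_(Pcols X0)) : (n <= j)%N -> j \in Pkeep X0 I.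
Proof.
move=> nj; rewrite inE; apply/existsP => -[k /andP[_ /eqP kj]].
by move: nj; rewrite -kj leqNgt ltn_ord.
Qed.

Let card_al : #|al| = \rank X0. Proof. exact: card_prefix. Qed.

Let card_albe : (#|al| + #|be| = n)%N.
Proof. by rewrite beta_setC cardsC card_ord. Qed.

(** The columns of P that are kept, other than those over the zero rows, are indexed
    by the right singular vectors: once with the sign + and once with the sign -. *)
Lemma sum_kept_columns (I : {set 'I_n}) (F : 'cV[R]_m -> 'cV[R]_n -> R) :
  \sum_(j in Pkeep X0 I) F (col j Pu) (col j Pv) =
  \sum_(k | k \notin I) F (col (w k) U) (col k V)
  + \sum_(k in be0) F (Num.sqrt 2 *: col k U) 0
  + \sum_k F (- col (w k) U) (col k V).
Proof.
rewrite /Pcols big_split_ord big_split_ord big_split_ord big_split_ord /=.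
have cu (J : {set 'I_n}) (a : 'I_#|J|) : col a (Ucols J) = col (w (enum_val a)) U.
  by apply/colP => i; rewrite !mxE.
have cv (J : {set 'I_n}) (a : 'I_#|J|) : col a (Vcols J) = col (enum_val a) V.
  by apply/colP => i; rewrite !mxE.
have cN p q (M : 'M[R]_(p, q)) j : col j (- M) = - col j M.
  by apply/colP => i; rewrite !mxE.
have cZ p q c (M : 'M[R]_(p, q)) j : col j (c *: M) = c *: col j M.
  by apply/colP => i; rewrite !mxE.
have c0 p q j : col j (0 : 'M[R]_(p, q)) = 0 by apply/colP => i; rewrite !mxE.
rewrite -(sum_enum_val_split _ _ beta_setC) [\sum_(k in be0) _]big_enum_val.
rewrite -[X in _ = _ + X](sum_enum_val_split _ _ beta_setC).
rewrite -!addrA; congr (_ + (_ + (_ + (_ + _)))).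
- apply: eq_big => [a|a _]; last by rewrite /Pu /Pv !colKl cu cv.
  by apply: Pkeep_lt => /=; rewrite [RHS]val_enum_prefix.
- apply: eq_big => [b|b _]; last by rewrite /Pu /Pv !(colKr, colKl) cu cv.
  by apply: Pkeep_lt => /=; rewrite card_al [RHS]val_enum_suffix.
- apply: eq_big => [c|c _]; first by apply: Pkeep_ge; rewrite /= addnA card_albe leq_addr.
  by rewrite /Pu /Pv !(colKr, colKl) cZ c0 col_colsub.
- apply: eq_big => [a|a _]; first by apply: Pkeep_ge; rewrite /= addnA card_albe leq_addr.
  by rewrite /Pu /Pv !(colKr, colKl) cN cu cv.
- apply: eq_big => [b|b _]; first by apply: Pkeep_ge; rewrite /= addnA card_albe leq_addr.
  by rewrite /Pu /Pv !colKr cN cu cv.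
Qed.

(** Column k of P, with the sign + or -, is an eigenvector of bigB X0 for x_k or - x_k,
    and the columns over the zero rows are in its kernel. *)
Lemma alpha_termE mu : 0 < mu ->
  alpha_term hnm X0 U V Y H mu = \sum_(l in alpha_ X0 mu) y l 0 *
    (\sum_(k | x k 0 != mu) (2^-1 * (h (w l) k + h (w k) l)) ^+ 2 / (mu - x k 0)
     + \sum_(k in be0) (2^-1 * (Num.sqrt 2 * h k l)) ^+ 2 / mu
     + \sum_k (2^-1 * (h (w l) k - h (w k) l)) ^+ 2 / (mu + x k 0)).
Proof.
move=> mu0; have [x0 _] := xs.
have X0h k : bil X0 (col (w k) U) (col k V) = x k 0.
  rewrite bil_col X0E !mulmxA Uo mul1mx -mulmxA Vo mulmx1.
  by rewrite rdiag_widen eqxx.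
have alpha_muE k : (k \in alpha_ X0 mu) = (x k 0 == mu).
  rewrite inE alphaE sX0; have [->|_] := eqVneq (x k 0) mu; last by rewrite andbF.
  by rewrite gt_eqF.
(* Counting the kept columns with eigenvalue mu by the same sum over columns shows
   that there are none, so the denominators do not vanish. *)
have bad0 : \sum_(j in Pkeep X0 (alpha_ X0 mu))
    (mu - bil X0 (col j Pu) (col j Pv) == 0)%:R = 0 :> R.
  rewrite (sum_kept_columns _ (fun a b => (mu - bil X0 a b == 0)%:R)).
  rewrite big1 => [|k]; last first.
    by rewrite alpha_muE X0h subr_eq0 eq_sym => /negPf ->.
  rewrite big1 => [|k _]; last by rewrite bil0r subr0 gt_eqF.
  rewrite big1 ?addr0// => k _; rewrite bilNl X0h opprK gt_eqF//.
  by rewrite ltr_pwDl.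
rewrite alpha_term_columns => [|j jI]; last first.
  have := psumr_eq0P (fun i _ => ler0n R _) bad0 jI.
  by move=> /eqP; rewrite pnatr_eq0 eqb0.
apply: eq_bigr => l _; congr (_ * _).
rewrite (sum_kept_columns _ (column_term mu l)) /column_term; congr (_ + _ + _).
- by apply: eq_big => [k|k _]; rewrite ?alpha_muE// X0h !bil_col.
- by apply: eq_bigr => k _; rewrite !bil0r bilZl bil_col add0r subr0.
- by apply: eq_bigr => k _; rewrite !bilNl X0h !bil_col opprK.
Qed.

Lemma beta_termE :
  beta_term hnm X0 U V Y H =
  - \sum_(k | x k 0 == 0) y k 0 * \sum_(l | x l 0 != 0) h (w k) l * h (w l) k / x l 0.
Proof.
rewrite /beta_term; set hb := hbeta hnm X0.
rewrite mxdotNr mxdotE; congr (- _).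
set G := colsub _ U.
have ME (i : 'I_#|hb|) (k : 'I_#|be|) :
    (G^T *m H *m Vcols al *m invmx (Sigma_alpha X0) *m (Ucols al)^T *m H *m Vcols be) i k =
    \sum_(l | x l 0 != 0) h (enum_val i) l * h (w l) (enum_val k) / x l 0.
  rewrite /Sigma_alpha invmx_diag => [|j]; last by rewrite mxE sX0 -alphaE enum_valP.
  rewrite -(eq_bigl _ _ alphaE) big_enum_val.
  set D := diag_mx _; set L := G^T *m H *m _.
  have -> : L *m D *m (Ucols al)^T *m H *m Vcols be = L *m D *m ((Ucols al)^T *m H *m Vcols be).
    by rewrite !mulmxA.
  rewrite [LHS]mxE; apply: eq_bigr => a _.
  rewrite /D mul_mx_diag [X in X * _]mxE [X in _ * X * _]mxE [X in X^-1]mxE sX0.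
  rewrite /L !mulmx_bil !col_colsub !bil_col.
  by rewrite mulrAC.
transitivity (\sum_(i in hb) \sum_(k in be) Sigma Y i k *
    \sum_(l | x l 0 != 0) h i l * h (w l) k / x l 0).
  rewrite [RHS]big_enum_val; apply: eq_bigr => i _.
  rewrite [RHS]big_enum_val; apply: eq_bigr => k _.
  by rewrite ME mxE.
rewrite exchange_big (eq_bigl _ _ betaE); apply: eq_bigr => k xk.
have wk : w k \in hb by rewrite inE; apply/orP; left; apply: imset_f; rewrite betaE.
rewrite (bigD1 (w k))//= [X in _ + X]big1 ?addr0; first by rewrite mxE eqxx sY.
move=> i; rewrite -/hb => /andP[_ ik].
rewrite mxE ifF ?mul0r//; apply: contraNF ik => /eqP ik.
by apply/eqP/val_inj.
Qed.

(** Collecting the coefficient of each singular value of Y: an index l belongs to the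
    alpha term of mu = x_l when x_l is nonzero, and to the beta term otherwise. *)
Lemma alpha_beta_terms :
  \sum_(mu <- mus X0) alpha_term hnm X0 U V Y H mu + beta_term hnm X0 U V Y H =
  \sum_l y l 0 * (if x l 0 == 0 then
      - \sum_(k | x k 0 != 0) h (w l) k * h (w k) l / x k 0
    else \sum_(k | x k 0 != x l 0) (2^-1 * (h (w l) k + h (w k) l)) ^+ 2 / (x l 0 - x k 0)
     + \sum_(k in be0) (2^-1 * (Num.sqrt 2 * h k l)) ^+ 2 / x l 0
     + \sum_k (2^-1 * (h (w l) k - h (w k) l)) ^+ 2 / (x l 0 + x k 0)).
Proof.
have [x0 _] := xs.
rewrite [RHS](bigID (fun l => x l 0 == 0)) /= addrC beta_termE -sumrN; congr (_ + _); last first.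
  by apply: eq_bigr => l /= ->; rewrite mulrN.
pose T mu l := y l 0 *
    (\sum_(k | x k 0 != mu) (2^-1 * (h (w l) k + h (w k) l)) ^+ 2 / (mu - x k 0)
     + \sum_(k in be0) (2^-1 * (Num.sqrt 2 * h k l)) ^+ 2 / mu
     + \sum_k (2^-1 * (h (w l) k - h (w k) l)) ^+ 2 / (mu + x k 0)).
have mus_in l : (x l 0 \in mus X0) = (x l 0 != 0).
  rewrite mem_undup; apply/mapP/idP => [[k + ->]|xl].
    by rewrite mem_filter sX0 => /andP[].
  exists l; last by rewrite sX0.
  by rewrite mem_filter sX0 xl mem_enum.
have mus_gt0 mu : mu \in mus X0 -> 0 < mu.
  rewrite mem_undup => /mapP[k + ->]; rewrite mem_filter sX0 => /andP[xk _].
  by rewrite lt0r xk x0.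
transitivity (\sum_(mu <- mus X0) \sum_(l | (x l 0 != 0) && (x l 0 == mu)) T mu l).
  rewrite big_seq [RHS]big_seq; apply: eq_bigr => mu /mus_gt0 mu0.
  rewrite alpha_termE//; apply: eq_bigl => l.
  by rewrite inE alphaE sX0.
rewrite (exchange_big_dep (fun l => x l 0 != 0)) /= => [|mu l _ /andP[]//].
apply: eq_bigr => l xl; rewrite (negPf xl).
rewrite big_mkcond /= (bigD1_seq (x l 0)) ?undup_uniq ?mus_in//= eqxx big1 ?addr0// => mu.
by rewrite eq_sym => /negPf ->.
Qed.

(** The symmetry conditions read D_ik x_k = D_ki x_i and x_i D_ik = x_k D_ki entrywise,
    and together they give D_ik (x_i^2 - x_k^2) = 0. *)
Lemma compatible_entries (D : 'M[R]_(m, n)) :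
  (D *m (rdiag m x)^T)^T = D *m (rdiag m x)^T ->
  ((rdiag m x)^T *m D)^T = (rdiag m x)^T *m D ->
  (forall i k, x i 0 != 0 -> D (w i) k = D (w k) i) /\
  (forall i k, x i 0 != x k 0 -> D (w i) k = 0) /\
  (forall (k : 'I_m) l, (n <= k)%N -> x l 0 != 0 -> D k l = 0).
Proof.
move=> c1 c2; have [x0 _] := xs.
have DDx (k : 'I_m) l : (D *m (rdiag m x)^T) k (w l) = D k l * x l 0.
  rewrite mxE (bigD1 l)//= big1 ?addr0 => [|j jl]; first by rewrite !mxE eqxx.
  by rewrite [in X in _ * X]mxE rdiag_widen eq_sym (negPf jl) mulr0.
have DDx0 l (k : 'I_m) : (n <= k)%N -> (D *m (rdiag m x)^T) l k = 0.
  move=> nk; rewrite mxE big1// => j _; rewrite mxE [rdiag _ _ _ _]mxE.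
  by rewrite gtn_eqF ?mulr0// (leq_trans (ltn_ord j)).
have DxD k l : ((rdiag m x)^T *m D) k l = x k 0 * D (w k) l.
  rewrite mxE (bigD1 (w k))//= big1 ?addr0 => [|j jk]; first by rewrite !mxE eqxx.
  rewrite mxE [rdiag _ _ _ _]mxE ifF ?mul0r//; apply: contraNF jk => /eqP jk.
  by apply/eqP/val_inj.
have e1 i k : D (w i) k * x k 0 = D (w k) i * x i 0.
  by rewrite -!DDx -[in LHS]c1 mxE.
have e2 i k : x i 0 * D (w i) k = x k 0 * D (w k) i.
  by rewrite -!DxD -[in LHS]c2 mxE.
have e3 i k : D (w i) k * ((x i 0 - x k 0) * (x i 0 + x k 0)) = 0.
  have : D (w i) k * ((x i 0 - x k 0) * (x i 0 + x k 0)) =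
    x i 0 * (x i 0 * D (w i) k) - x k 0 * (D (w i) k * x k 0) by ring.
  by rewrite e1 e2 => ->; ring.
have D0 i k : x i 0 != x k 0 -> D (w i) k = 0.
  move=> xik; have /eqP := e3 i k; rewrite !mulf_eq0 subr_eq0 (negPf xik) /=.
  case/orP => [/eqP //|]; rewrite paddr_eq0// => /andP[/eqP xi /eqP xk].
  by rewrite xi xk eqxx in xik.
split; last split => //.
- move=> i k xi; have [xik|xik] := eqVneq (x i 0) (x k 0); last first.
    by rewrite D0// D0// eq_sym.
  by have := e2 i k; rewrite -xik => /(mulfI xi).
- move=> k l nk xl; have : D k l * x l 0 = 0 by rewrite -DDx -c1 mxE DDx0.
  by move/eqP; rewrite mulf_eq0 (negPf xl) orbF => /eqP.
Qed.

(** Both sides are linear in the singular values y of Y. The compatible part D cancels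
    from the coefficient of y_l, which is then a sum over k of quadratic forms in the
    entries A_lk and B_lk of the velocities of the frames. *)
Lemma explicit_frame_curvature (A : 'M[R]_m) (B : 'M[R]_n) (D : 'M[R]_(m, n)) :
  skewsym A -> skewsym B -> h = D + A *m rdiag m x + rdiag m x *m B ->
  (D *m (rdiag m x)^T)^T = D *m (rdiag m x)^T ->
  ((rdiag m x)^T *m D)^T = (rdiag m x)^T *m D ->
  2 * \sum_(mu <- mus X0) alpha_term hnm X0 U V Y H mu + 2 * beta_term hnm X0 U V Y H =
  frame_curvature x y A B.
Proof.
move=> As Bs hE c1 c2; have [x0 _] := xs.
have [Dsym [D0 Dlow]] := compatible_entries c1 c2.
have Ask i k : A k i = - A i k by have := congr1 (fun M : 'M[R]_m => M i k) As; rewrite !mxE.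
have Bsk i k : B k i = - B i k by have := congr1 (fun M : 'M[R]_n => M i k) Bs; rewrite !mxE.
have hw i k : h (w i) k = D (w i) k + A (w i) (w k) * x k 0 + x i 0 * B i k.
  by rewrite {1}hE 2!mxE mulmx_rdiag rdiag_mulmx.
have hlow (k : 'I_m) l : (n <= k)%N -> x l 0 != 0 -> h k l = A k (w l) * x l 0.
  by move=> nk xl; rewrite {1}hE 2!mxE mulmx_rdiag rdiag_mulmx0// addr0 Dlow// add0r.
rewrite -mulrDr alpha_beta_terms /frame_curvature mxdotC (mxdot_rdiag hnm).
rewrite mulr_sumr -sumrN; apply: eq_bigr => l _.
have sum_rows (F : 'I_m -> R) : \sum_k F k = \sum_k F (w k) + \sum_(k in be0) F k.
  rewrite (bigID (fun k : 'I_m => (k < n)%N)) /= big_ord_narrow; congr (_ + _).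
  by apply: eq_bigl => k; rewrite inE -leqNgt.
have AA : (A *m A *m rdiag m x) (w l) l =
    - (\sum_k x l 0 * A (w l) (w k) ^+ 2 + \sum_(k in be0) x l 0 * A (w l) k ^+ 2).
  rewrite mulmx_rdiag mxE -sum_rows mulr_suml -sumrN; apply: eq_bigr => k _.
  by rewrite (Ask (w l) k); ring.
have BB : (rdiag m x *m (B *m B)) (w l) l = - \sum_k x l 0 * B l k ^+ 2.
  rewrite rdiag_mulmx mxE mulr_sumr -sumrN; apply: eq_bigr => k _.
  by rewrite (Bsk l k); ring.
have AB : (A *m rdiag m x *m B) (w l) l = - \sum_k A (w l) (w k) * x k 0 * B l k.
  rewrite mxE -sumrN; apply: eq_bigr => k _; rewrite mulmx_rdiag (Bsk l k); ring.
have E3 (M1 M2 M3 : 'M[R]_(m, n)) i j :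
    (M1 + M2 + 2 *: M3) i j = M1 i j + M2 i j + 2 * M3 i j by rewrite !mxE.
rewrite E3 AA BB AB mulrCA -mulrN; congr (_ * _); rewrite mulrN -!opprD opprK.
have [xl|xl] := eqVneq (x l 0) 0.
  rewrite [X in _ = X + _ + _](_ : _ = 0); last first.
    by rewrite !big1 ?addr0// => k _; rewrite xl mul0r.
  rewrite [X in _ = _ + X + _](_ : _ = 0); last first.
    by rewrite big1// => k _; rewrite xl mul0r.
  rewrite !add0r mulrN -mulrN -sumrN; congr (_ * _); rewrite big_mkcond; apply: eq_bigr => k _.
  have [xk|xk] := eqVneq (x k 0) 0; first by rewrite xk mulr0 mul0r.
  have lk : x l 0 != x k 0 by rewrite xl eq_sym.
  have kl : x k 0 != x l 0 by rewrite eq_sym.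
  rewrite /= (hw l k) (hw k l) (D0 _ _ lk) (D0 _ _ kl) xl (Bsk l k).
  by field.
have be0E : \sum_(k in be0) (2^-1 * (Num.sqrt 2 * h k l)) ^+ 2 / x l 0 =
    2^-1 * \sum_(k in be0) x l 0 * A (w l) k ^+ 2.
  rewrite mulr_sumr; apply: eq_bigr => k; rewrite inE => nk.
  rewrite hlow// exprMn exprMn sqr_sqrtr// (Ask (w l) k).
  by field.
rewrite be0E big_mkcond /=; set P := \sum_k _; set S := \sum_k _; set Z := \sum_(k in _) _.
(* For x_k different from x_l the two quotients combine, because
   (a - b)^2 (x_l - x_k) + (a + b)^2 (x_l + x_k) is twice
   x_l a^2 + x_l b^2 + 2 x_k a b; for equal values only the second quotient is
   present and equals the whole. *)
have PS : 2 * (P + S) = \sum_k x l 0 * A (w l) (w k) ^+ 2 + \sum_k x l 0 * B l k ^+ 2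
    + 2 * \sum_k A (w l) (w k) * x k 0 * B l k.
  rewrite /P /S -big_split /= !mulr_sumr -!big_split /=; apply: eq_bigr => k _.
  have xlk : x l 0 + x k 0 != 0 by rewrite paddr_eq0// (negPf xl).
  have -> : h (w l) k - h (w k) l = (A (w l) (w k) + B l k) * (x l 0 + x k 0).
    by rewrite !hw (Dsym l k xl) (Ask (w l) (w k)) (Bsk l k); ring.
  have [xkl|xkl] /= := eqVneq (x k 0) (x l 0).
    by rewrite xkl in xlk *; field.
  have -> : h (w l) k + h (w k) l = (A (w l) (w k) - B l k) * (x k 0 - x l 0).
    have lk : x l 0 != x k 0 by rewrite eq_sym.
    rewrite (hw l k) (hw k l) (D0 _ _ lk) (D0 _ _ xkl) (Ask (w l) (w k)) (Bsk l k).
    by ring.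
  field; rewrite xlk subr_eq0 eq_sym xkl //.
have -> : 2 * (P + 2^-1 * Z + S) = 2 * (P + S) + Z by field.
by rewrite PS; ring.
Qed.

End ExplicitFormula.

(** * Second-order expansion of psi *)

Lemma is_derive_quadratic (R : realType) (a b c : R) :
  is_derive c 1 (fun s : R => a * s + 2^-1 * b * (s * s)) (a + b * c).
Proof.
have d0 := @is_derive_id R R c 1.
have d1 := is_deriveD (is_deriveZ a d0) (is_deriveZ (2^-1 * b) (is_deriveM d0 d0)).
have e : a *: (1 : R) + (2^-1 * b) *: (id c *: (1 : R) + id c *: (1 : R)) = a + b * c.
  by rewrite /GRing.scale /= !mulr1; field.
by rewrite -e; exact: d1.
Qed.

Section Taylor.
Context {R : realType} {p q : nat}.
Local Notation E := 'M[R]_(p, q).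
Variables (psi : E -> R).
Hypothesis psi2 : twice_differentiable psi.
Implicit Types (X w : E) (t : R).

Lemma diff_gradient X w : 'd psi X w = mxdot (gradient psi X) w.
Proof.
rewrite {1}(matrix_sum_delta w) mxdotE linear_sum; apply: eq_bigr => i _.
rewrite linear_sum; apply: eq_bigr => j _.
by rewrite linearZ /= !mxE mulrC.
Qed.

Lemma is_derive_line X w t :
  is_derive t 1 (fun s => psi (X + s *: w)) (mxdot (gradient psi (X + t *: w)) w).
Proof.
have [dpsi _] := psi2.
have E (h : R) : h^-1 *: (((fun s => psi (X + s *: w)) \o shift t) (h *: 1) - psi (X + t *: w)) =
    h^-1 *: ((psi \o shift (X + t *: w)) (h *: w) - psi (X + t *: w)).
  by rewrite /= [h *: 1]mulr1 scalerDl addrCA.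
split.
  rewrite /derivable; under eq_fun do rewrite E.
  exact: diff_derivable.
rewrite /derive; under eq_fun do rewrite E.
by rewrite -diff_gradient -deriveE.
Qed.

Lemma mxdot_norm_le (A B : E) : `|mxdot A B| <= (p * q)%:R * (`|A| * `|B|).
Proof.
rewrite mxdotE (le_trans (ler_norm_sum _ _ _))//.
rewrite (@le_trans _ _ (\sum_(i < p) \sum_(j < q) `|A| * `|B|))//; last first.
  by rewrite !sumr_const !card_ord -!mulrnA -[leLHS]mulr_natl mulnC.
apply: ler_sum => i _; rewrite (le_trans (ler_norm_sum _ _ _))//.
by apply: ler_sum => j _; rewrite normrM ler_pM// entry_le_mx_norm.
Qed.

Lemma remainder_slope (g1 g2 l w : E) (c : R) :
  mxdot g1 w - (mxdot g2 w + mxdot l w * c) = mxdot (g1 - g2 - c *: l) w.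
Proof. by rewrite !mxdotBl mxdotZl; ring. Qed.

(** The Peano form of the second-order expansion, uniform in the direction: the
    remainder is a difference of gradients, by the mean value theorem. *)
Lemma taylor2 X H :
  (fun tw : R * E => (psi (X + tw.1 *: tw.2) - psi X - tw.1 * mxdot (gradient psi X) tw.2)
     / (2^-1 * tw.1 ^+ 2)) @ dirs H --> hessian psi X H H.
Proof.
have [dpsi dgrad] := psi2.
pose G := gradient psi; pose L : E -> E := 'd G X.
have Lc : continuous L by exact: diff_continuous.
have hc : (fun tw : R * E => mxdot (L tw.2) tw.2) @ dirs H --> hessian psi X H H.
  apply: cvg_mxdot; last exact: dirs_snd.
  exact: (cvg_comp (fun tw : R * E => tw.2) L (@dirs_snd _ _ _ H) (Lc H)).
suff rem : (fun tw : R * E => (psi (X + tw.1 *: tw.2) - psi X - tw.1 * mxdot (gradient psi X) tw.2)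
     / (2^-1 * tw.1 ^+ 2) - mxdot (L tw.2) tw.2) @ dirs H --> (0 : R).
  have FF : Filter (dirs H) by exact: dirs_proper.
  have lim := cvgD rem hc; move: lim => /(_ FF); rewrite add0r => lim.
  apply: cvg_trans lim; apply: near_eq_cvg.
  by near=> tw; rewrite /= subrK.
have lo : forall e : R, 0 < e -> \forall Z \near (0 : E),
    `|G (X + Z) - G X - L Z| <= e * `|Z|.
  move=> e e0; have /eqaddoP/(_ _ e0) := diff_locally (dgrad X).
  apply: filterS => Z lZ; rewrite [X + Z]addrC -addrA -opprD; exact: lZ.
apply/cvgrPdistC_lt => e e0.
pose K : R := (p * q)%:R; pose M := `|H| + 1.
have K0 : 0 <= K by rewrite ler0n.
have M0 : 0 < M by rewrite ltr_pwDr.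
pose e' := e / (2 * (K + 1) * M ^+ 2).
have den0 : 0 < 2 * (K + 1) * M ^+ 2 by rewrite !mulr_gt0 ?exprn_gt0// ltr_pwDr.
have e'0 : 0 < e' by rewrite divr_gt0.
have /nbhs_normP[delta /= d0 lod] := lo _ e'0.
near=> tw.
have t0 : 0 < tw.1 by near: tw; exact: dirs_gt0.
have tM : tw.1 < delta / M.
  near: tw; apply: (near_dirs_fst H (P := fun t => t < delta / M)).
  by apply: nbhs_right_lt; rewrite divr_gt0.
have wM : `|tw.2| < M.
  near: tw; have cn : (fun tw : R * E => `|tw.2|) @ dirs H --> `|H|.
    by apply: cvg_norm; exact: dirs_snd.
  by apply: (cvgr_lt _ cn); rewrite ltrDl.
move: tw.1 tw.2 t0 tM wM => t w t0 tM wM.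
pose a := mxdot (gradient psi X) w; pose b := mxdot (L w) w.
have LZ c : L (c *: w) = c *: L w by rewrite /L linearZ.
pose phi (s : R) := psi (X + s *: w) - (a * s + 2^-1 * b * (s * s)).
have dphi (c : R) : is_derive c 1 phi (mxdot (G (X + c *: w) - G X - L (c *: w)) w).
  have d1 := is_derive_line X w c.
  have d2 := is_derive_quadratic a b c.
  have d3 := is_deriveB d1 d2; rewrite LZ -remainder_slope.
  exact: d3.
have [|c cin phit] := MVT_segment (ltW t0) (fun c _ => dphi c).
  by apply: derivable_within_continuous => c _; case: (dphi c).
have [c0 ct] : 0 <= c /\ c <= t by move: cin; rewrite in_itv /= => /andP[].
have phi0 : phi t - phi 0 = psi (X + t *: w) - psi X - t * a - 2^-1 * t ^+ 2 * b.
  by rewrite /phi scale0r addr0; ring.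
have cw : `|c *: w| <= t * M.
  by rewrite normrZ ger0_norm// ler_pM// ltW.
have rest : `|mxdot (G (X + c *: w) - G X - L (c *: w)) w| <= K * (e' * (t * M) * M).
  apply: le_trans (mxdot_norm_le _ _) _; rewrite ler_wpM2l// ler_pM// ?(ltW wM)//.
  apply: le_trans (lod _ _) _; last by rewrite ler_wpM2l// ltW.
  by rewrite /ball_ /= sub0r normrN (le_lt_trans cw)// -ltr_pdivlMr.
have -> : (psi (X + t *: w) - psi X - t * mxdot (gradient psi X) w) / (2^-1 * t ^+ 2) - mxdot (L w) w - 0
   = 2 * (phi t - phi 0) / t ^+ 2.
  by rewrite phi0 -/a -/b; field; rewrite gt_eqF.
rewrite phit subr0; move: (mxdot (_ - _ - _) w) rest => r rest.
have -> : 2 * (r * t) / t ^+ 2 = 2 * r / t by field; rewrite gt_eqF.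
rewrite normrM normfV (gtr0_norm t0) ltr_pdivrMr// normrM normr_nat.
apply: (@le_lt_trans _ _ (2 * (K * (e' * (t * M) * M)))); first by rewrite ler_pM2l.
have -> : 2 * (K * (e' * (t * M) * M)) = (K / (K + 1)) * (e * t).
  by rewrite /e'; field; rewrite !gt_eqF// ltr_pwDr.
rewrite gtr_pMl ?mulr_gt0// ltr_pdivrMr ?ltr_pwDr// mul1r.
by rewrite ltrDl.
Unshelve. all: by end_near. Qed.

End Taylor.

(** * Second-order optimality conditions *)

Section SecondOrderConditions.
Context {R : realType} {p q : nat}.
Local Notation E := 'M[R]_(p, q).
Variables (psi : E -> R) (g : E -> \bar R) (X0 : E).
Let Y := - gradient psi X0.
Let obj X := ((psi X)%:E + g X)%E.
Hypotheses (psi2 : twice_differentiable psi) (gsub : subdifferential g X0 Y).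

Let psiq (tw : R * E) : R :=
  (psi (X0 + tw.1 *: tw.2) - psi X0 - tw.1 * mxdot (gradient psi X0) tw.2)
    / (2^-1 * tw.1 ^+ 2).

Let gq (tw : R * E) : \bar R :=
  ((g (X0 + tw.1 *: tw.2)%R - g X0 - (tw.1 * mxdot Y tw.2)%:E)
   * ((2^-1 * tw.1 ^+ 2)^-1)%:E)%E.

(** The first-order terms cancel because Y is minus the gradient of psi. *)
Let growth_quotient (tw : R * E) (r : R) : 0 < tw.1 ->
  (obj X0 + (r * (2^-1 * tw.1 ^+ 2))%:E <= obj (X0 + tw.1 *: tw.2))%E
  = (r%:E <= (psiq tw)%:E + gq tw)%E.
Proof.
move=> t0; have s0 : 0 < 2^-1 * tw.1 ^+ 2 by rewrite mulr_gt0 ?exprn_gt0 ?invr_gt0.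
have si : 0 < (2^-1 * tw.1 ^+ 2)^-1 by rewrite invr_gt0.
case: gsub => + _; rewrite /obj /gq /psiq /Y.
case: (g X0) => // a _; case: (g _) => [v||] /=.
- rewrite -!EFinD !lee_fin mxdotNl mulrN opprK.
  rewrite -mulrDl ler_pdivlMr//; apply/idP/idP; lra.
- by rewrite mulyr (gtr0_sg si) mul1e !leey.
- by rewrite mulNyr (gtr0_sg si) mul1e.
Qed.

(** The objective grows along every difference quotient, so the quotients of g are
    bounded below by minus those of psi, which converge. *)
Lemma second_order_necessary H : (\forall X \near X0, (obj X0 <= obj X)%E) ->
  (0 <= (hessian psi X0 H H)%:E + second_subderivative g X0 Y H)%E.
Proof.
move=> locmin; rewrite addeC -leeBlDr// sub0e -EFinN.
apply: le_limf_einf => c; rewrite lte_fin => cH.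
have lim : psiq @ dirs H --> hessian psi X0 H H by exact: (taylor2 psi2).
near=> tw.
have t0 : 0 < tw.1 by near: tw; exact: dirs_gt0.
have ple : psiq tw < - c by near: tw; apply: cvgr_lt lim _ _; lra.
have : (obj X0 <= obj (X0 + tw.1 *: tw.2))%E.
  near: tw; have cX : (fun tw : R * E => X0 + tw.1 *: tw.2) @ dirs H --> X0.
    rewrite -[X in _ --> X]addr0 -(scale0r H); apply: cvgD; first exact: cvg_cst.
    by apply: cvgZ; [exact: dirs_fst|exact: dirs_snd].
  exact: cX locmin.
have := growth_quotient 0 t0; rewrite mul0r adde0 => ->; rewrite -/(gq tw).
case: (gq tw) => [v||] /=; rewrite ?leey// -EFinD !lee_fin; lra.
Unshelve. all: by end_near. Qed.

(** Quadratic growth with constant c bounds the sum of the two second-order quotients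
    below by twice c times the squared norm of the direction. *)
Lemma growth_second_order (eps c : R) : 0 < eps -> 0 < c ->
  (forall X, frobenius (X - X0) <= eps ->
     (obj X0 + (c * frobenius (X - X0) ^+ 2)%:E <= obj X)%E) ->
  forall H, H != 0 -> (0 < (hessian psi X0 H H)%:E + second_subderivative g X0 Y H)%E.
Proof.
move=> eps0 c0 grow H H0.
have HH : 0 < mxdot H H.
  rewrite lt_neqAle mxdot_ge0 andbT eq_sym; apply: contra H0 => /eqP H0.
  by apply/eqP/mxdot_eq0.
apply: (@lt_le_trans _ _ (2 * c * mxdot H H)%:E); first by rewrite lte_fin !mulr_gt0.
rewrite addeC -leeBlDr// -EFinB.
apply: le_limf_einf => r; rewrite lte_fin => rH.
have lim : (fun tw => 2 * c * mxdot tw.2 tw.2 - psiq tw) @ dirs H -->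
    2 * c * mxdot H H - hessian psi X0 H H.
  apply: cvgB; last exact: taylor2.
  by apply: cvgMr; apply: cvg_mxdot; exact: dirs_snd.
near=> tw.
have t0 : 0 < tw.1 by near: tw; exact: dirs_gt0.
have ple : r < 2 * c * mxdot tw.2 tw.2 - psiq tw by near: tw; exact: cvgr_gt lim _ _.
have small : frobenius (X0 + tw.1 *: tw.2 - X0) <= eps.
  rewrite addrAC subrr add0r.
  near: tw; have fl : (fun tw : R * E => frobenius (tw.1 *: tw.2)) @ dirs H --> (0 : R).
    have <- : frobenius (0 *: H) = 0 by rewrite frobeniusZ normr0 mul0r.
    have cX : (fun tw : R * E => tw.1 *: tw.2) @ dirs H --> 0 *: H.
      by apply: cvgZ; [exact: dirs_fst|exact: dirs_snd].
    exact: (cvg_comp _ _ (cvg_mxdot cX cX) (@sqrt_continuous R _)).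
  exact: cvgr_le fl _ eps0.
have stepE : X0 + tw.1 *: tw.2 - X0 = tw.1 *: tw.2 by rewrite addrAC subrr add0r.
have := grow _ small; rewrite stepE sqr_frobenius mxdotZl mxdotZr.
have -> : c * (tw.1 * (tw.1 * mxdot tw.2 tw.2)) =
    2 * c * mxdot tw.2 tw.2 * (2^-1 * tw.1 ^+ 2) by field.
rewrite growth_quotient// -/(gq tw).
case: (gq tw) => [v||] /=; rewrite ?leey// -EFinD !lee_fin; lra.
Unshelve. all: by end_near. Qed.

Let compact_sphere : compact [set w : E | frobenius w = 1].
Proof.
apply: (@bounded_closed_compact_mx _ _ _ _ 1) => [w /= w1 i j|].
  by rewrite -w1 entry_le_frobenius.
have -> : [set w : E | frobenius w = 1] = (fun w => mxdot w w) @^-1` [set 1].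
  apply/seteqP; split=> w /=; first by rewrite -sqr_frobenius => ->; rewrite expr1n.
  by rewrite /frobenius => ->; rewrite sqrtr1.
apply: closed_comp => [w _|]; last exact: closed_eq.
have idc : continuous (fun w : E => w) by move=> ?; exact: cvg_id.
exact: continuous_mxdot.
Qed.

(** Growth in a neighbourhood of one unit direction: for a critical direction by the
    sign of the second-order term, otherwise already at first order. *)
Let growth_near w : (critical_cone g X0 Y w ->
    (0 < (hessian psi X0 w w)%:E + second_subderivative g X0 Y w)%E) ->
  exists2 c0 : R, 0 < c0 & \forall tw \near dirs w,
    forall c, c <= c0 -> (obj X0 + (c * tw.1 ^+ 2)%:E <= obj (X0 + tw.1 *: tw.2))%E.
Proof.
have lim : psiq @ dirs w --> hessian psi X0 w w by exact: (taylor2 psi2).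
have mono tw r : 0 < tw.1 -> (r%:E <= (psiq tw)%:E + gq tw)%E ->
    forall c, c <= r / 2 -> (obj X0 + (c * tw.1 ^+ 2)%:E <= obj (X0 + tw.1 *: tw.2))%E.
  move=> t0 rq c cr; have -> : c * tw.1 ^+ 2 = 2 * c * (2^-1 * tw.1 ^+ 2) by field.
  rewrite growth_quotient//; apply: le_trans rq; rewrite lee_fin; lra.
have [wcrit /(_ wcrit) pos|wncrit _] := pselect (critical_cone g X0 Y w).
  have [r r0 rlt] := exists_EFin_between pos; rewrite lte_fin in r0.
  exists (r / 2); first by rewrite divr_gt0.
  move: rlt; rewrite addeC -lteBlDr// -EFinB => /exists_EFin_between[r1 rr1 r1lt].
  rewrite lte_fin in rr1.
  have near_g : \forall tw \near dirs w, (r1%:E < gq tw)%E := lt_limf_einf r1lt.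
  near=> tw.
  have t0 : 0 < tw.1 by near: tw; exact: dirs_gt0.
  apply: mono => //.
  have pgt : r - r1 < psiq tw by near: tw; apply: cvgr_gt lim _ _; lra.
  have : (r1%:E < gq tw)%E by near: tw; exact: near_g.
  case: (gq tw) => [v||] //=; rewrite ?leey// lte_fin => r1v.
  rewrite -EFinD lee_fin; lra.
have : (subderivative g X0 w != (mxdot Y w)%:E)%E by apply/eqP.
have sub := subgradient_le_subderivative w gsub.
rewrite eq_sym => ne; have {sub ne} : ((mxdot Y w)%:E < subderivative g X0 w)%E.
  by rewrite lt_neqAle ne sub.
move=> /exists_EFin_between[s Ys slt]; rewrite lte_fin in Ys.
have near_g : \forall tw \near dirs w,
    (s%:E < (g (X0 + tw.1 *: tw.2)%R - g X0) * (tw.1^-1)%:E)%E := lt_limf_einf slt.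
have plim : (fun tw => mxdot (gradient psi X0) tw.2 + tw.1 * (2^-1 * psiq tw)) @ dirs w
    --> - mxdot Y w.
  rewrite /Y mxdotNl opprK -[X in _ --> X]addr0 -(mul0r (2^-1 * hessian psi X0 w w)).
  apply: cvgD; first by apply: cvg_mxdot; [exact: cvg_cst|exact: dirs_snd].
  by apply: cvgM; [exact: dirs_fst|apply: cvgMr].
pose de := (s - mxdot Y w) / 2; have de0 : 0 < de by rewrite divr_gt0// subr_gt0.
exists 1 => //; near=> tw => c c1.
have t0 : 0 < tw.1 by near: tw; exact: dirs_gt0.
have td : tw.1 < de.
  by near: tw; apply: (near_dirs_fst w (P := fun t => t < de)); exact: nbhs_right_lt.
have pgt : - mxdot Y w - de < mxdot (gradient psi X0) tw.2 + tw.1 * (2^-1 * psiq tw).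
  by near: tw; apply: cvgr_gt plim _ _; rewrite ltrBlDr ltrDl.
have : (s%:E < (g (X0 + tw.1 *: tw.2)%R - g X0) * (tw.1^-1)%:E)%E by near: tw; exact: near_g.
have pE : tw.1 * (mxdot (gradient psi X0) tw.2 + tw.1 * (2^-1 * psiq tw)) =
    psi (X0 + tw.1 *: tw.2) - psi X0.
  by rewrite /psiq; field; rewrite gt_eqF.
case: gsub => + _; rewrite /obj; case: (g X0) => // a _; case: (g _) => [v||] /=.
- rewrite -EFinD lte_fin ltr_pdivlMr// => sv; rewrite -!EFinD lee_fin.
  have c2 : c * tw.1 ^+ 2 <= de * tw.1.
    rewrite expr2 mulrA ler_pM2r//; apply: le_trans (ltW td).
    by rewrite -[leRHS]mul1r ler_pM2r.
  move: pgt; rewrite -(ltr_pM2l t0) pE => pgt.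
  rewrite /de in c2 pgt *; lra.
- by rewrite addey// leey.
- by rewrite mulNyr gtr0_sg ?invr_gt0// mul1e.
Unshelve. all: by end_near. Qed.

(** Growth is uniform in the direction by compactness of the unit sphere, and every
    displacement is its norm times a unit direction. *)
Lemma second_order_sufficient :
  (forall H, critical_cone g X0 Y H -> H != 0 ->
     (0 < (hessian psi X0 H H)%:E + second_subderivative g X0 Y H)%E) ->
  exists eps c : R, [/\ 0 < eps, 0 < c & forall X, frobenius (X - X0) <= eps ->
       (obj X0 + (c * frobenius (X - X0) ^+ 2)%:E <= obj X)%E].
Proof.
move=> pos.
have /compact_near_coveringP cover := compact_sphere.
have := cover _ (filter_prod (0 : R)^'+ (0 : R)^'+) (fun tc w =>
   (obj X0 + (tc.2 * tc.1 ^+ 2)%:E <= obj (X0 + tc.1 *: w))%E) _ _.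
case=> [w /= w1|[A B] /= [A0 B0] AB].
  have w0 : w != 0.
    by apply/eqP => w0; move: w1; rewrite w0 /frobenius mxdot0r sqrtr0 => /eqP; rewrite eq_sym oner_eq0.
  have [c0 c00 [[S W] /= [S0 Ww] SW]] := growth_near (fun cr => pos w cr w0).
  exists (W, S `*` [set c | c <= c0]) => /=.
    split=> //; exists (S, [set c | c <= c0]) => //=; split => //.
    exact: nbhs_right_le.
  move=> [w' [t c]] /= [Ww' [St cc0]].
  by have := SW (t, w') (conj St Ww') c cc0.
have [c [c0 Bc]] : exists c, 0 < c /\ B c.
  have : \forall c \near (0 : R)^'+, 0 < c /\ B c.
    by apply: filterS2 (nbhs_right_gt 0) B0.
  by move/filter_ex.
have [eps eps0 epsA] : exists2 eps : R, 0 < eps & forall t, 0 < t -> t < eps -> A t.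
  have [eps /= eps0 epsA] := A0; exists eps => // t t0 te.
  by apply: epsA => //=; rewrite sub0r normrN gtr0_norm.
exists (eps / 2), c; split=> [||X Xe]//; first by rewrite divr_gt0.
have := sqrtr_ge0 (mxdot (X - X0) (X - X0)); rewrite -/(frobenius (X - X0)).
rewrite le0r => /predU1P[X0E|t0].
  rewrite X0E expr0n mulr0 adde0; suff -> : X = X0 by [].
  by apply/eqP; rewrite -subr_eq0; apply/eqP/frobenius_eq0.
set t := frobenius (X - X0) in Xe t0 *.
have At : A t by apply: epsA => //; lra.
have := AB (t, c) (conj At Bc) (t^-1 *: (X - X0)) _.
have -> : X0 + (t, c).1 *: (t^-1 *: (X - X0)) = X.
  by rewrite /= scalerA mulfV ?gt_eqF// scale1r addrC subrK.
apply.
by rewrite /= frobeniusZ gtr0_norm ?invr_gt0// -/t mulVf// gt_eqF.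
Qed.

End SecondOrderConditions.

(** * Optimality conditions for functions of singular values *)

Theorem theorem5p8 (R : realType) (m n : nat) (hnm : (n <= m)%N)
    (psi : 'M[R]_(m, n) -> R) (f : 'cV[R]_n -> \bar R)
    (X0 : 'M[R]_(m, n)) (U : 'M[R]_m) (V : 'M[R]_n) :
  let fs : 'M[R]_(m, n) -> \bar R := fun X => f (sigma X) in
  let Y : 'M[R]_(m, n) := - gradient psi X0 in
  let obj : 'M[R]_(m, n) -> \bar R := fun X => ((psi X)%:E + fs X)%E in
  let q : 'M[R]_(m, n) -> \bar R := qform hnm X0 U V psi f Y in
  twice_differentiable psi ->
  absolutely_symmetric f ->
  lower_semicontinuous f ->
  econvex f ->
  loc_lipschitz_dom f ->
  fs X0 \is a fin_num ->
  subdifferential fs X0 Y ->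
  parabolically_epi_differentiable f (sigma X0) ->
  parabolically_regular f (sigma X0) (sigma Y) ->
  (svd_pairs X0 `&` svd_pairs Y) (U, V) ->
  ((\forall X \near X0, (obj X0 <= obj X)%E) ->
     forall H, critical_cone fs X0 Y H -> (0 <= q H)%E)
  /\
  ((forall H, critical_cone fs X0 Y H -> H != 0 -> (0 < q H)%E) <->
   exists eps c : R, [/\ 0 < eps, 0 < c &
     forall X, frobenius (X - X0) <= eps ->
       (obj X0 + (c * frobenius (X - X0) ^+ 2)%:E <= obj X)%E]).
Proof.
move=> fs Y obj q psi2 fsym _ _ _ _ gsub _ _ [[/= Uo Vo X0E] [_ _ YE]].
have qE H : critical_cone fs X0 Y H ->
    q H = ((hessian psi X0 H H)%:E + second_subderivative fs X0 Y H)%E.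
  move=> Hcrit.
  have [A [B [D [[As Bs] HE c1 c2 ->]]]] := critical_expansion hnm fsym
    (sigma_sorted X0) (sigma_sorted Y) Uo Vo X0E YE gsub Hcrit.
  rewrite -(explicit_frame_curvature hnm (erefl (sigma X0)) (erefl (sigma Y))
    Uo Vo X0E As Bs HE c1 c2).
  by rewrite EFinD !addeA.
split=> [locmin H Hcrit|].
  by rewrite qE//; exact: second_order_necessary locmin.
split=> [pos|[eps [c [eps0 c0 grow]]] H Hcrit H0].
  apply: second_order_sufficient => // H Hcrit H0.
  by rewrite -qE//; exact: pos.
rewrite qE//; exact: (growth_second_order psi2 gsub eps0 c0 grow H0).
Qed.
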